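(* Let $f:[a,b]\times\mathbb{R}\to\mathbb{R}$ be a continuous function and $\alpha>0$ a real. If $y^*_\alpha$ is a solution of the system $$\left\{\begin{array}{l} {_a^CD_t^{\alpha}}y(t)=f(t,y),\quad \alpha\in(0,1)\\ y(a)=y_a,\end{array}\right.$$ where ${_a^CD_t^{\alpha}}$ is the Caputo fractional derivative of order $\alpha$, and if the limit $$\lim_{\alpha\to1^\pm}y^*_\alpha(t):=y^*(t)$$ exists for all $t\in[a,b]$, then $y^*$ is a solution of the Cauchy problem $$\left\{\begin{array}{l} y'(t)=f(t,y)\\ y(a)=y_a.\end{array}\right.$$
   Context: Here $a<b$ and $y_a$ are real numbers, and $f(t,y)$ stands for $f(t,y(t))$. For $\alpha\in(0,1)$ the Caputo fractional derivative of order $\alpha$ of a function $y:[a,b]\to\mathbb{R}$ is $${_a^CD_t^{\alpha}}y(t)=\frac{1}{\Gamma(1-\alpha)}\int_a^t (t-s)^{-\alpha}y'(s)\,ds,$$ where $\Gamma$ is the Gamma function. The fractional system is posed for orders $\alpha\in(0,1)$; its solution $y^*_\alpha$ is then considered as a function depending on the parameter $\alpha>0$, and the limit of this function as $\alpha\to1$ is taken from both sides ($\alpha\to1^-$ and $\alpha\to1^+$), which is what $\alpha\to1^\pm$ denotes. *)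

(* Defs.v *)
From HB Require Import structures.
From mathcomp Require Import all_boot all_order all_algebra.
From mathcomp Require Import all_classical all_reals all_analysis.

Set Implicit Arguments.
Unset Strict Implicit.
Unset Printing Implicit Defensive.

Import Order.TTheory GRing.Theory Num.Theory.
Import numFieldNormedType.Exports.

Local Open Scope classical_set_scope.
Local Open Scope ring_scope.

(* MathComp-Analysis.  A function on [a, b] is represented by a total function
   R -> R whose values outside [a, b] are irrelevant. *)

(* Euler's integral; meaningful for z > 0. *)
Definition Gamma (R : realType) (z : R) : R :=
  \int[lebesgue_measure]_(x in `]0, +oo[) (x `^ (z - 1) * expR (- x)).

Definition caputo_integrand (R : realType) (alpha : R) (y : R -> R)
    (t s : R) : R :=
  (t - s) `^ (- alpha) * derive1 y s.

(* Rintegral returns a junk value on non-integrable functions, so statements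
   about [caputo] are to be paired with [caputo_exists].  The values of derive1 y
   at the end points of [a, b] do not affect the integral. *)
Definition caputo_exists (R : realType) (a alpha : R) (y : R -> R)
    (t : R) : Prop :=
  lebesgue_measure.-integrable `[a, t]
    (fun s => (caputo_integrand alpha y t s)%:E).

Definition caputo (R : realType) (a alpha : R) (y : R -> R) (t : R) : R :=
  (Gamma (1 - alpha))^-1 *
    \int[lebesgue_measure]_(s in `[a, t]) caputo_integrand alpha y t s.

(* The class AC[a, b]: y is differentiable almost everywhere, y' is summable
   and y is the integral of y'.  This is the regularity under which y' in the
   Caputo derivative is meaningful; it contains C^1[a, b] as well as functions
   such as t |-> (t - a) `^ alpha with 0 < alpha < 1, whose derivative blows up
   at a. *)
Definition absolutely_continuous_on (R : realType) (a b : R)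
    (y : R -> R) : Prop :=
  [/\ {ae lebesgue_measure, forall t : R, t \in `]a, b[ -> derivable y t 1},
      lebesgue_measure.-integrable `[a, b] (fun t => (derive1 y t)%:E) &
      forall t : R, t \in `[a, b] ->
        y t = y a + \int[lebesgue_measure]_(s in `[a, t]) derive1 y s].

(* The equation is imposed on ]a, b]: at t = a the integral is over a single
   point, so the equation would degenerate to f a ya = 0. *)
Definition caputo_solution (R : realType) (a b ya : R) (f : R -> R -> R)
    (alpha : R) (y : R -> R) : Prop :=
  [/\ absolutely_continuous_on a b y,
      y a = ya &
      forall t : R, t \in `]a, b] ->
        caputo_exists a alpha y t /\ caputo a alpha y t = f t (y t)].

(* l is the derivative at t of the restriction of y to D: two-sided when t is
   interior to D, one-sided at the end points of an interval. *)
Definition is_derive_on (R : realType) (D : set R) (y : R -> R)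
    (t l : R) : Prop :=
  (y x - y t) / (x - t) @[x --> within D t^'] --> l.

Definition cauchy_solution (R : realType) (a b ya : R) (f : R -> R -> R)
    (y : R -> R) : Prop :=
  y a = ya /\
  forall t : R, t \in `[a, b] -> is_derive_on `[a, b] y t (f t (y t)).

(* Main.v *)
Require Import Defs.
From HB Require Import structures.
From mathcomp Require Import all_boot all_order all_algebra.
From mathcomp Require Import all_classical all_reals all_analysis.
From mathcomp Require Import measurable_realfun ring lra.
Import Order.TTheory GRing.Theory Num.Theory.
Import numFieldNormedType.Exports.
Local Open Scope classical_set_scope.
Local Open Scope ring_scope.

(** Two integral identities drive the proof.  By Fubini, a solution y of the
    fractional equation with right-hand side g satisfies the Volterra equation
      B(1 - al, al) (y(t) - y(a)) = Gamma(1 - al) \int_a^t (t - r)^(al - 1) g(r) dr,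
    and its Caputo derivative can be integrated by parts into
      Gamma(1 - al) g(t) = (t - a)^(- al) (y(t) - y(a))
         + al \int_a^t (t - r)^(- al - 1) (y(t) - y(r)) dr.
    The first one bounds the increments of y by those of g: it makes the
    solutions Hoelder continuous uniformly in al wherever g is bounded, and in
    the limit it gives |ystar x - ystar t - l (x - t)| <= eta (x - t) as soon as
    |g - l| <= eta on ]t, x[, which is the differential equation.  The second
    one is a maximum principle: a solution cannot cross upwards a line of slope
    larger than sup f when al is close to 1.

    Pointwise convergence does not bound the solutions uniformly, so f(t, y)
    is not known to be bounded.  The set of the T such that the solutions are
    uniformly bounded on [a, T] for al close to 1 is open on the right by the
    Hoelder estimate, and closed by the maximum principle. *)

Set Implicit Arguments.
Unset Strict Implicit.
Unset Printing Implicit Defensive.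

(** * Integrals of power kernels with end-point singularities *)

(** Exhaustion by compact subintervals, the usual fundamental theorem on each of them, and monotone
    convergence. The sign of f lets it blow up at both ends, as power kernels do. *)
Lemma ge0_FTC2_oo (R : realType) (f F : R -> R) (c d : R) : c < d ->
  (forall x, x \in `]c, d[ -> 0 <= f x) ->
  (forall x, x \in `]c, d[ -> is_derive x 1 F (f x)) ->
  (forall x, x \in `]c, d[ -> {for x, continuous f}) ->
  F x @[x --> c^'+] --> F c -> F x @[x --> d^'-] --> F d ->
  (\int[lebesgue_measure]_(x in `]c, d[) (f x)%:E = (F d - F c)%:E)%E.
Proof.
move=> cd f0 dF cf Fc Fd.
(* The 3 keeps the interval from c + e n to d - e n nondegenerate already for n = 0. *)
pose e n : R := (d - c) / (3 + n%:R).
have dc0 : 0 < d - c by rewrite subr_gt0.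
have e0 n : 0 < e n by rewrite /e divr_gt0// ltr_wpDr.
have e3 n : e n *+ 3 <= d - c.
  rewrite /e -mulrnAl ler_pdivrMr ?ltr_wpDr// -mulr_natr ler_wpM2l ?(ltW dc0)//.
  by rewrite lerDl.
have ecvg : e n @[n --> \oo] --> 0.
  rewrite -[X in _ --> X](mulr0 (d - c)); apply: cvgM; first exact: cvg_cst.
  apply/gtr0_cvgV0; first by near=> n; rewrite ltr_wpDr.
  by apply/cvgryPge => r; near do rewrite -lerBlDl; exact: nbhs_infty_ger.
pose A n := `[c + e n, d - e n]%classic.
have ncA n : c + e n < d - e n by have := e0 n; have := e3 n; lra.
have Aoo n x : A n x -> x \in `]c, d[.
  by rewrite /A/= !in_itv/= => /andP[? ?]; have := e0 n; lra.
have bigA : \bigcup_n A n = `]c, d[%classic.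
  apply/seteqP; split=> [x [n _ /Aoo//]|x /=].
  rewrite in_itv/= => /andP[cx xd].
  have m0 : 0 < Num.min (x - c) (d - x) by rewrite lt_min !subr_gt0 cx.
  have /cvgrPdist_lt /(_ _ m0) [N _ /(_ N (leqnn N))] := ecvg.
  rewrite sub0r normrN gtr0_norm// lt_min => /andP[? ?].
  by exists N => //; rewrite /A/= in_itv/=; apply/andP; split; lra.
have emono n m : (n <= m)%N -> e m <= e n.
  by move=> nm; rewrite ler_pM2l// lef_pV2 ?posrE ?ltr_wpDr// lerD2l ler_nat.
have cfA n : {within A n, continuous f}.
  by apply: continuous_in_subspaceT => x /set_mem /Aoo; exact: cf.
have := @ge0_nondecreasing_set_cvg_integral _ (measurableTypeR R) R A (EFin \o f) lebesgue_measure.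
rewrite bigA => cvgA.
have IA n : (\int[lebesgue_measure]_(x in A n) (EFin \o f) x = (F (d - e n) - F (c + e n))%:E)%E.
  rewrite EFinB; apply: (continuous_FTC2 (ncA n) (cfA n)).
  - split.
    + by move=> x xA; apply: ex_derive; apply: dF; apply: (Aoo n); apply: subset_itv_oo_cc.
    + apply: cvg_at_right_filter; apply: differentiable_continuous; apply/derivable1_diffP.
      by apply: ex_derive; apply: dF; apply: (Aoo n); rewrite /A/= in_itv/= lexx ltW.
    + apply: cvg_at_left_filter; apply: differentiable_continuous; apply/derivable1_diffP.
      by apply: ex_derive; apply: dF; apply: (Aoo n); rewrite /A/= in_itv/= lexx ltW.
  - move=> x xA; rewrite derive1E; apply: derive_val.
    by apply: dF; apply: (Aoo n); apply: subset_itv_oo_cc.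
have {}cvgA : (\int[lebesgue_measure]_(x in A n) (EFin \o f) x @[n --> \oo] -->
    \int[lebesgue_measure]_(x in `]c, d[) (f x)%:E)%E.
  apply: cvgA.
  - by move=> n m nm; rewrite subsetEset; apply: subset_itv; rewrite bnd_simp; have := emono _ _ nm; lra.
  - by move=> n; exact: measurable_itv.
  - move=> n; apply/measurable_EFinP; apply: subspace_continuous_measurable_fun => //; exact: measurable_itv.
  - by move=> n x /Aoo xA; rewrite lee_fin; exact: f0.
have cvgF : (\int[lebesgue_measure]_(x in A n) (EFin \o f) x @[n --> \oo] --> (F d - F c)%:E)%E.
  under eq_cvg do rewrite IA.
  apply: cvg_EFin; first exact: nearW.
  apply: cvgB.
  - move/cvg_at_leftP : Fd; apply; split; first by move=> n; rewrite gtrBl.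
    by rewrite -[X in _ --> X]subr0; apply: cvgB => //; exact: cvg_cst.
  - move/cvg_at_rightP : Fc; apply; split; first by move=> n; rewrite ltrDl.
    by rewrite -[X in _ --> X]addr0; apply: cvgD => //; exact: cvg_cst.
exact: (cvg_unique _ cvgA cvgF).
Unshelve. all: by end_near. Qed.

Lemma measurable_powRBl (R : realType) (D : set R) (t q : R) :
  measurable_fun D (fun s => (t - s) `^ q).
Proof.
rewrite (_ : (fun s => _) = ((@powR R) ^~ q) \o (fun s => t - s))//.
by apply: measurableT_comp => //; exact: measurable_funB.
Qed.

Lemma powRBl_cvg0 (R : realType) (q t : R) : 0 < q ->
  (t - x) `^ q @[x --> t^'-] --> 0.
Proof.
move=> q0; apply/cvg_at_leftP => u [ut ucvg].
have /cvg_at_rightP := powR_cvg0 q0; apply; split; first by move=> n; rewrite subr_gt0.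
by rewrite -[X in _ --> X](subrr t); apply: cvgB => //; exact: cvg_cst.
Qed.

Lemma is_derive_powRBl (R : realType) (q t s : R) : s < t ->
  is_derive s 1 (fun s => (t - s) `^ q) (- (q * (t - s) `^ (q - 1))).
Proof.
move=> st; have ts : 0 < t - s by rewrite subr_gt0.
have h1 : is_derive s 1 (fun s : R => t - s) (-1).
  have := @is_deriveB _ _ _ (cst t) (@id R) s 1 _ _
            (is_derive_cst t s 1) (is_derive_id s 1).
  by rewrite sub0r.
have h2 := is_derive1_powR q ts.
have := @is_derive1_comp _ ((@powR R) ^~ q) (fun s => t - s) s _ _ h2 h1.
by rewrite mulrN1.
Qed.

Lemma is_derive1_continuous (R : realType) (f : R -> R) (x l : R) :
  is_derive x 1 f l -> {for x, continuous f}.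
Proof.
move=> fl; apply: differentiable_continuous.
by apply/derivable1_diffP; exact: ex_derive.
Qed.

(** The last hypothesis keeps d away from the singularity t unless the exponent p is positive.
    Negative p is needed too: [caputo_abel_by_parts] takes p = - al. *)
Lemma integral_powRBl (R : realType) (p c d t : R) (b1 b2 : bool) : p != 0 ->
  c < d -> d <= t -> (0 < p) || (d < t) ->
  (\int[lebesgue_measure]_(s in [set` Interval (BSide b1 c) (BSide b2 d)])
     ((t - s) `^ (p - 1))%:E = (((t - c) `^ p - (t - d) `^ p) / p)%:E)%E.
Proof.
move=> p0 cd dt pd.
rewrite integral_itv_bndoo; last by apply/measurable_EFinP; exact: measurable_powRBl.
pose F : R -> R := - p^-1 *: (fun s => (t - s) `^ p).
have FE x : F x = - p^-1 * (t - x) `^ p by [].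
have dF s : s < t -> is_derive s 1 F ((t - s) `^ (p - 1)).
  move=> st; have h := is_derive_powRBl p st.
  have : is_derive s 1 F (- p^-1 *: - (p * (t - s) `^ (p - 1))) by exact: is_deriveZ.
  rewrite (_ : - p^-1 *: - (p * (t - s) `^ (p - 1)) = (t - s) `^ (p - 1))//.
  by rewrite -[LHS]/(- p^-1 * - (p * (t - s) `^ (p - 1))); field.
transitivity (F d - F c)%:E; last first.
  by congr (_ %:E); rewrite !FE; field.
apply: (ge0_FTC2_oo cd).
- by move=> x _; exact: powR_ge0.
- by move=> x; rewrite in_itv/= => /andP[_ xd]; apply: dF; lra.
- move=> x; rewrite in_itv/= => /andP[_ xd].
  by apply: is_derive1_continuous; apply: is_derive_powRBl; lra.
- by apply: cvg_at_right_filter; apply: is_derive1_continuous; apply: dF; lra.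
- have [dlt|dget] := ltP d t.
    by apply: cvg_at_left_filter; apply: is_derive1_continuous; exact: dF.
  (* At d = t the integrand may blow up, so the left limit of F is computed directly; [powR0] gives
     F t = 0 because p > 0. *)
  have dE : d = t by lra.
  rewrite -[F]/(fun x => - p^-1 * (t - x) `^ p).
  apply: (@cvgM _ _ _ _ (fun=> - p^-1) (fun s => (t - s) `^ p)); first exact: cvg_cst.
  move: pd; rewrite dE ltxx orbF => p0'; rewrite subrr powR0//.
  exact: powRBl_cvg0.
Qed.

Lemma powR_le1 (R : realType) (x q : R) : 0 <= x <= 1 -> 0 <= q -> x `^ q <= 1.
Proof.
move=> /andP[x0 x1] q0; have <- : 1 `^ q = 1 :> R by rewrite powR1.
by apply: ge0_ler_powR; rewrite ?nnegrE.
Qed.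

Lemma powR_cvg_at (R : realType) (q t : R) : 0 < q -> 0 <= t ->
  (x `^ q) @[x --> t^'+] --> t `^ q.
Proof.
move=> q0; rewrite le_eqVlt => /predU1P[<-|t0].
  by rewrite powR0 ?gt_eqF//; exact: powR_cvg0.
apply: cvg_at_right_filter.
exact: is_derive1_continuous (is_derive1_powR _ t0).
Qed.

Lemma integral_powR (R : realType) (p c d : R) (b1 b2 : bool) : 0 < p ->
  0 <= c -> c < d ->
  (\int[lebesgue_measure]_(s in [set` Interval (BSide b1 c) (BSide b2 d)])
     (s `^ (p - 1))%:E = ((d `^ p - c `^ p) / p)%:E)%E.
Proof.
move=> p0 c0 cd.
rewrite integral_itv_bndoo; last by apply/measurable_EFinP; apply: measurable_funTS; exact: measurable_powR.
pose F : R -> R := p^-1 *: (fun s => s `^ p).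
have FE x : F x = p^-1 * x `^ p by [].
have dF (s : R) : 0 < s -> is_derive s 1 F (s `^ (p - 1)).
  move=> st; have h := is_derive1_powR p st.
  have : is_derive s 1 F (p^-1 *: (p * s `^ (p - 1))) by exact: is_deriveZ.
  rewrite (_ : p^-1 *: (p * s `^ (p - 1)) = s `^ (p - 1))//.
  by rewrite -[LHS]/(p^-1 * (p * s `^ (p - 1))); field; rewrite gt_eqF.
transitivity (F d - F c)%:E; last first.
  by congr (_ %:E); rewrite !FE; field; rewrite gt_eqF.
apply: (ge0_FTC2_oo cd).
- by move=> x _; exact: powR_ge0.
- by move=> x; rewrite in_itv/= => /andP[xc _]; apply: dF; lra.
- move=> x; rewrite in_itv/= => /andP[xc _].
  have x0 : 0 < x by lra.
  exact: is_derive1_continuous (is_derive1_powR _ x0).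
- rewrite -[F]/(fun x => p^-1 * x `^ p).
  apply: (@cvgM _ _ _ _ (fun=> p^-1) (fun s => s `^ p)); first exact: cvg_cst.
  exact: powR_cvg_at.
- by apply: cvg_at_left_filter; apply: is_derive1_continuous; apply: dF; lra.
Qed.

Lemma ler_powRN (R : realType) (c d q : R) : 0 <= q -> 0 < c -> c <= d ->
  d `^ (- q) <= c `^ (- q).
Proof.
move=> q0 c0 cd; have d0 := lt_le_trans c0 cd.
rewrite !powRN lef_pV2 ?posrE ?powR_gt0//.
by apply: ge0_ler_powR; rewrite ?nnegrE// ltW.
Qed.

(** * Behaviour of the Gamma and beta constants near 0 *)

(** The integral is cut at 1. The tail is at most that of expR (- x), hence at most 1. On the rest,
    the integrand is at most x^(z - 1), whose integral is 1 / z, and falls short of it by at most x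
    * x^(z - 1) <= 1. *)
Lemma Gamma_bounds (R : realType) (z : R) : 0 < z < 1 ->
  1 - z <= z * Gamma z <= 1 + z.
Proof.
move=> /andP[z0 z1]; pose mu := @lebesgue_measure R.
pose g x : R := x `^ (z - 1) * expR (- x).
have mg (D : set R) : measurable_fun D (fun x => (g x)%:E).
  apply/measurable_EFinP; apply: measurable_funM; first by apply: measurable_funTS; exact: measurable_powR.
  by apply: measurableT_comp => //; exact: measurable_funN.
have g0 x : (0 <= (g x)%:E)%E by rewrite lee_fin mulr_ge0 ?powR_ge0 ?expR_ge0.
have p01 : (\int[mu]_(x in `]0%R, 1%R]) (x `^ (z - 1))%:E = (z^-1)%:E)%E.
  by rewrite integral_powR// powR1 powR0 ?gt_eqF// subr0 mul1r.
have mp (D : set R) : measurable_fun D (fun x => (x `^ (z - 1))%:E).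
  by apply/measurable_EFinP; apply: measurable_funTS; exact: measurable_powR.
have split01 : `]0%R, +oo[%classic = (`]0%R, 1%R] `|` `]1%R, +oo[)%classic :> set R.
  by rewrite -itv_bndbnd_setU// bnd_simp.
have Isplit : (\int[mu]_(x in `]0%R, +oo[) (g x)%:E =
   \int[mu]_(x in `]0%R, 1%R]) (g x)%:E + \int[mu]_(x in `]1%R, +oo[) (g x)%:E)%E.
  rewrite split01 ge0_integral_setU//; first exact: mg.
  by apply/disj_setPS => y [/=]; rewrite !in_itv/= andbT; lra.
have up1 : (\int[mu]_(x in `]0%R, 1%R]) (g x)%:E <= (z^-1)%:E)%E.
  rewrite -p01; apply: ge0_le_integral => //; [exact: mg|exact: mp|].
  move=> x; rewrite /= in_itv/= => /andP[x0 _].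
  rewrite lee_fin /g ler_piMr ?powR_ge0// -expR0 ler_expR; lra.
have up2 : (\int[mu]_(x in `]1%R, +oo[) (g x)%:E <= 1)%E.
  rewrite -(integral_exponential_pdf (@ltr01 R)).
  apply: (@le_trans _ _ (\int[mu]_(x in `]1%R, +oo[) (exponential_pdf 1 x)%:E)%E).
    apply: ge0_le_integral => //.
    - exact: mg.
    - apply/measurable_EFinP; apply: measurable_funTS; exact: measurable_exponential_pdf.
    - move=> x; rewrite /= in_itv/= andbT => x1.
      rewrite lee_fin exponential_pdfE /g; last lra.
      rewrite mul1r mulN1r ler_piMl ?expR_ge0//.
      by rewrite -[leRHS](powRr0 x) ler_powR; lra.
  apply: ge0_subset_integral => //.
  - apply/measurable_EFinP; exact: measurable_exponential_pdf.
  - by move=> x _; rewrite lee_fin exponential_pdf_ge0.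
have low1 : ((z^-1)%:E <= \int[mu]_(x in `]0%R, 1%R]) (g x)%:E + 1)%E.
  have -> : (1 = \int[mu]_(x in `]0%R, 1%R]) (cst 1 x) :> \bar R)%E.
    by rewrite integral_cst//= lebesgue_measure_itv/= lte_fin ltr01 mul1e oppr0 adde0.
  rewrite -p01 -ge0_integralD//; last exact: mg.
  apply: ge0_le_integral => //.
  - by move=> x _; rewrite lee_fin powR_ge0.
  - exact: mp.
  - by apply: emeasurable_funD => //; exact: mg.
  - move=> x; rewrite /= in_itv/= => /andP[x0 x1].
    rewrite -EFinD lee_fin /g.
    have e1 : 1 - x <= expR (- x) by have := expR_ge1Dx (- x); lra.
    have h1 : x * x `^ (z - 1) <= 1.
      by rewrite mulr_powRB1; [apply: powR_le1|..]; lra.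
    have := powR_ge0 x (z - 1); nra.
have I2 : (0 <= \int[mu]_(x in `]1%R, +oo[) (g x)%:E)%E by exact: integral_ge0.
have I1 : (0 <= \int[mu]_(x in `]0%R, 1%R]) (g x)%:E)%E by exact: integral_ge0.
rewrite /Gamma /Rintegral -/(g _) -/mu Isplit.
move: I1 I2 up1 up2 low1.
case: (\int[mu]_(x in `]0%R, 1%R]) (g x)%:E)%E => [r1| |] //.
case: (\int[mu]_(x in `]1%R, +oo[) (g x)%:E)%E => [r2| |] //.
rewrite -EFinD !lee_fin /= => r10 r20 r1z r21 lz.
have zz : z * z^-1 = 1 by rewrite mulfV// gt_eqF.
by apply/andP; split; nra.
Qed.

Definition beta_kernel (R : realType) (z x : R) : R := (1 - x) `^ (- z) * x `^ (z - 1).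

Lemma measurable_beta_kernel (R : realType) (D : set R) (z : R) :
  measurable_fun D (beta_kernel z).
Proof.
apply: measurable_funM; first exact: measurable_powRBl.
by apply: measurable_funTS; exact: measurable_powR.
Qed.

(** Separates the singularities at 0 and 1 into a sum whose terms integrate explicitly. For x <=
    1/2, (1 - x)^(- z) <= 1 + 2 x and the excess 2 x * x^(z - 1) is at most 2; for x > 1/2, x^(z -
    1) <= 2. *)
Lemma beta_kernel_bounds (R : realType) (z x : R) : 0 < z < 1 -> 0 < x < 1 ->
  x `^ (z - 1) <= beta_kernel z x <= x `^ (z - 1) + 2 * (1 - x) `^ (- z).
Proof.
move=> /andP[z0 z1] /andP[x0 x1].
have y1 : 1 <= (1 - x) `^ (- z).
  by rewrite powRN invf_ge1; [apply: powR_le1|apply: powR_gt0]; lra.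
have p0 := powR_ge0 x (z - 1).
rewrite /beta_kernel; apply/andP; split; first by rewrite ler_peMl.
have [xh|xh] := leP x (2^-1).
- have h1 : (1 - x) `^ (- z) <= 1 + 2 * x.
    rewrite powRN; apply: (@le_trans _ _ (1 - x)^-1).
      rewrite lef_pV2 ?posrE; [|apply: powR_gt0; lra|lra].
      by apply: ger1_powR; lra.
    by rewrite -div1r ler_pdivrMr; nra.
  have h2 : x * x `^ (z - 1) <= 1.
    by rewrite mulr_powRB1; [apply: powR_le1|..]; lra.
  nra.
- have h1 : x `^ (z - 1) <= 2.
    rewrite (_ : z - 1 = - (1 - z)); last ring.
    rewrite powRN invf_ple ?posrE ?powR_gt0//.
    apply: (@le_trans _ _ x); first exact: ltW.
    by apply: ger1_powR; lra.
  nra.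
Qed.

(* Euler's beta integral B(z, 1 - z); the reflection formula is never needed,
   only that z * B(z, 1 - z) tends to 1 as z tends to 0. *)
Definition beta_const (R : realType) (z : R) : R :=
  \int[lebesgue_measure]_(x in `[0, 1]) beta_kernel z x.

Lemma beta_const_bounds (R : realType) (z : R) : 0 < z < 1 ->
  lebesgue_measure.-integrable `[0, 1] (EFin \o beta_kernel z) /\
  1 <= z * beta_const z <= 1 + 2 * z / (1 - z).
Proof.
move=> z01; have [z0 z1] := andP z01; pose mu := @lebesgue_measure R.
have zn : z != 0 by lra.
have mb (D : set R) : measurable_fun D (fun x => (beta_kernel z x)%:E).
  by apply/measurable_EFinP; exact: measurable_beta_kernel.
have m1 (D : set R) : measurable_fun D (fun x => (x `^ (z - 1))%:E).
  by apply/measurable_EFinP; apply: measurable_funTS; exact: measurable_powR.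
have m2 (D : set R) : measurable_fun D (fun x => (2 * (1 - x) `^ (- z))%:E).
  by apply/measurable_EFinP; apply: measurable_funM => //; exact: measurable_powRBl.
have I1 : (\int[mu]_(x in `]0%R, 1%R[) (x `^ (z - 1))%:E = (z^-1)%:E)%E.
  by rewrite integral_powR// powR1 powR0 ?gt_eqF// subr0 mul1r.
have I2 : (\int[mu]_(x in `]0%R, 1%R[) (2 * (1 - x) `^ (- z))%:E = (2 / (1 - z))%:E)%E.
  under eq_integral do rewrite EFinM.
  rewrite ge0_integralZl_EFin//.
  - have z10 : 1 - z != 0 by lra.
    have := @integral_powRBl R (1 - z) 0 1 1 false true z10 ltr01 (lexx _).
    rewrite (_ : 1 - z - 1 = - z); last ring.
    rewrite subr_gt0 z1 => /(_ isT) ->.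
    by rewrite subr0 subrr powR1 powR0// subr0 -EFinM mul1r.
  - by move=> x _; rewrite lee_fin powR_ge0.
  - by apply/measurable_EFinP; exact: measurable_powRBl.
have b0 x : 0 <= beta_kernel z x by rewrite mulr_ge0 ?powR_ge0.
have lo : ((z^-1)%:E <= \int[mu]_(x in `]0%R, 1%R[) (beta_kernel z x)%:E)%E.
  rewrite -I1; apply: ge0_le_integral => //; [|exact: m1|exact: mb|].
  - by move=> x _; rewrite lee_fin powR_ge0.
  - by move=> x /=; rewrite in_itv/= lee_fin => /(beta_kernel_bounds z01)/andP[].
have up : (\int[mu]_(x in `]0%R, 1%R[) (beta_kernel z x)%:E <= (z^-1 + 2 / (1 - z))%:E)%E.
  rewrite EFinD -I1 -I2 -ge0_integralD//; last first.
  - exact: m2.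
  - by move=> x _; rewrite lee_fin mulr_ge0 ?powR_ge0.
  - exact: m1.
  - by move=> x _; rewrite lee_fin powR_ge0.
  apply: ge0_le_integral => //.
  - by move=> x _; rewrite lee_fin.
  - exact: mb.
  - by apply: emeasurable_funD; [exact: m1|exact: m2].
  by move=> x /=; rewrite in_itv/= -EFinD lee_fin => /(beta_kernel_bounds z01)/andP[].
have Icc : (\int[mu]_(x in `[0%R, 1%R]) (beta_kernel z x)%:E =
            \int[mu]_(x in `]0%R, 1%R[) (beta_kernel z x)%:E)%E.
  by rewrite integral_itv_bndoo; last exact: mb.
have Bi : mu.-integrable `[0, 1] (EFin \o beta_kernel z).
  apply/integrableP; split; first exact: mb.
  under eq_integral => x _ do rewrite /= ger0_norm ?b0//.
  by rewrite [ltLHS]Icc; apply: le_lt_trans up _; rewrite ltry.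
split=> //; rewrite /beta_const /Rintegral -/mu Icc.
move: lo up; case: (\int[mu]_(x in `]0%R, 1%R[) (beta_kernel z x)%:E)%E => [r| |]//.
rewrite !lee_fin /= => lo up; apply/andP; split.
  by rewrite -(mulfV zn) ler_pM2l.
rewrite (_ : 1 + _ = z * (z^-1 + 2 / (1 - z))) ?ler_pM2l//.
by field; rewrite zn/=; lra.
Qed.

(** The two exponents add up to -1, so an affine change of variables leaves no factor and the value
    does not depend on s and t. This is what inverts Abel's equation in [volterra]. *)
Lemma integral_beta_kernel (R : realType) (z s t : R) : 0 < z < 1 -> s < t ->
  (\int[lebesgue_measure]_(r in `]s, t[) ((t - r) `^ (- z) * (r - s) `^ (z - 1))%:E
   = (beta_const z)%:E)%E.
Proof.
move=> z01 st; have ts0 : 0 < t - s by rewrite subr_gt0.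
have [Bi _] := beta_const_bounds z01.
pose P x : R := \int[lebesgue_measure]_(r in `[0, x]) beta_kernel z r.
have kc x : 0 < x < 1 -> {for x, continuous (beta_kernel z)}.
  move=> /andP[x0 x1]; apply: cvgM.
    exact: is_derive1_continuous (is_derive_powRBl _ x1).
  exact: is_derive1_continuous (is_derive1_powR _ x0).
have dP (x : R) : 0 < x < 1 -> is_derive x 1 P (beta_kernel z x).
  move=> x01; have [x0 x1] := andP x01.
  have [dx ex] := continuous_FTC1_closed x1 Bi x0 (kc _ x01).
  exact: (DeriveDef dx (etrans (esym (derive1E P x)) ex)).
have := parameterized_integral_continuous ler01 Bi.
move/continuous_within_itvP => /(_ ltr01)[_ P0 P1].
pose h r : R := (r - s) / (t - s).
have dh (r : R) : is_derive r 1 h ((t - s)^-1).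
  have := @is_deriveZ _ _ _ _ (t - s)^-1 r 1 _
     (@is_deriveB _ _ _ (@id R) (cst s) r 1 _ _ (is_derive_id r 1) (is_derive_cst s r 1)).
  rewrite subr0 (_ : _ *: _ = (t - s)^-1); last exact: mulr1.
  by rewrite (_ : _ \*: _ = h)//; apply/funext => x; rewrite /h mulrC.
have h01 r : s < r < t -> 0 < h r < 1.
  by move=> /andP[sr rt]; rewrite divr_gt0 ?subr_gt0//= ltr_pdivrMr// mul1r; lra.
have hcvg (u : nat -> R) l : u n @[n --> \oo] --> l -> h (u n) @[n --> \oo] --> h l.
  by move=> ul; apply: cvgMl; apply: cvgB => //; exact: cvg_cst.
have hs : h s = 0 by rewrite /h subrr mul0r.
have ht : h t = 1 by rewrite /h mulfV// gt_eqF.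
(* P is an antiderivative of the kernel on [0, 1], so the affine change of
   variables h amounts to differentiating P \o h. *)
transitivity ((P \o h) t - (P \o h) s)%:E; last first.
  by rewrite /= hs ht {2}/P set_itv1 Rintegral_set1 subr0.
apply: (ge0_FTC2_oo st).
- by move=> r _; rewrite mulr_ge0 ?powR_ge0.
- move=> r; rewrite in_itv/= => rst; have [sr rt] := andP rst.
  have := is_derive1_comp (dP _ (h01 _ rst)) (dh r).
  rewrite (_ : _ * _ = (t - r) `^ (- z) * (r - s) `^ (z - 1))//.
  rewrite /beta_kernel (_ : 1 - h r = (t - r) / (t - s)); last first.
    by rewrite /h; field; rewrite gt_eqF.
  rewrite /h !powRM ?invr_ge0; [|lra|lra|lra|lra].
  rewrite (_ : _ * _ * _ = (t - r) `^ (- z) * (r - s) `^ (z - 1) *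
     ((t - s)^-1 `^ (- z) * (t - s)^-1 `^ (z - 1) * (t - s)^-1)); last ring.
  rewrite -powRD; last by apply/implyP => _; rewrite gt_eqF ?invr_gt0.
  rewrite (_ : - z + (z - 1) = - 1); last ring.
  by rewrite powR_inv1 ?invr_ge0 ?ltW// invrK mulfV ?mulr1// gt_eqF.
- move=> r; rewrite in_itv/= => /andP[sr rt]; apply: cvgM.
    exact: is_derive1_continuous (is_derive_powRBl _ rt).
  have rs : 0 < r - s by lra.
  have h1 : {for r, continuous (fun r => r - s)}.
    by apply: cvgB; [exact: cvg_id|exact: cvg_cst].
  apply: (@continuous_comp _ _ _ (fun r => r - s) (fun x => x `^ (z - 1)) r h1).
  exact: is_derive1_continuous (is_derive1_powR _ rs).
- apply/cvg_at_rightP => u [su ucvg]; rewrite /= hs.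
  move/cvg_at_rightP : P0; apply; split; last by rewrite -hs; exact: hcvg.
  by move=> n; rewrite divr_gt0// subr_gt0.
- apply/cvg_at_leftP => u [ut ucvg]; rewrite /= ht.
  move/cvg_at_leftP : P1; apply; split; last by rewrite -ht; exact: hcvg.
  by move=> n; rewrite ltr_pdivrMr// mul1r; have := ut n; lra.
Qed.

(** * Fubini for a nonnegative kernel times an integrable density *)

(** As k is nonnegative, the integral of |k u| over the product is that of |K u|, which is finite,
    so Fubini applies. Integrability for every r makes the real-valued inner integral agree with the
    extended one everywhere on D. *)
Lemma kernel_fubini (R : realType) (D : set R) (u K : R -> R) (k : R * R -> R) :
  let mu := @lebesgue_measure R in
  measurable D -> measurable_fun D u -> measurable_fun setT k ->
  (forall p, 0 <= k p) ->
  (forall s, D s -> \int[mu]_(r in D) (k (s, r))%:E = (K s)%:E)%E ->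
  mu.-integrable D (fun s => (K s * u s)%:E) ->
  (forall r, D r -> mu.-integrable D (fun s => (k (s, r) * u s)%:E)) ->
  mu.-integrable D (fun r => (\int[mu]_(s in D) (k (s, r) * u s))%:E) /\
  \int[mu]_(s in D) (K s * u s) = \int[mu]_(r in D) \int[mu]_(s in D) (k (s, r) * u s).
Proof.
move=> mu mD mu_ mk k0 kK iK ik.
(* Extension by zero in both variables turns the problem into Fubini on the whole plane. *)
pose F (p : measurableTypeR R * measurableTypeR R) : R := (k p * \1_D p.2) * (u \_ D) p.1.
have m1D : measurable_fun setT (\1_D : R -> R) by exact: measurable_indic.
have muD : measurable_fun setT (u \_ D).
  by apply/(measurable_restrictT _ mD).
have mF : measurable_fun setT (EFin \o F).
  apply/measurable_EFinP; apply: measurable_funM; first apply: measurable_funM => //.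
    exact: measurableT_comp.
  exact: measurableT_comp.
have mk1 s : measurable_fun setT (fun r => k (s, r) * \1_D r).
  by apply: measurable_funM => //; apply: measurableT_comp.
have kD s : D s -> (\int[mu]_r (k (s, r) * \1_D r)%:E = (K s)%:E)%E.
  move=> Ds; rewrite -kK// [RHS]integral_mkcond; apply: eq_integral => r _.
  rewrite patchE indicE; case: ifP => _; first by rewrite mulr1.
  by rewrite mulr0.
have kDi s : D s -> mu.-integrable setT (EFin \o (fun r => k (s, r) * \1_D r)).
  move=> Ds; apply/integrableP; split; first by apply/measurable_EFinP; exact: mk1.
  under eq_integral => r _ do rewrite /= ger0_norm ?mulr_ge0//.
  by rewrite kD// ltry.
have uD s : ~ D s -> (u \_ D) s = 0.
  by move=> nDs; rewrite patchE ifF//; apply/negbTE; rewrite notin_setE.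
have uD1 s : D s -> (u \_ D) s = u s by move=> Ds; rewrite patchE mem_set.
have inner_abs s : (\int[mu]_r `|(EFin \o F) (s, r)| =
    `|((fun s => (K s * u s)%:E) \_ D) s|)%E.
  have [Ds|nDs] := pselect (D s); last first.
    rewrite patchE ifF; last by apply/negbTE; rewrite notin_setE.
    rewrite integral0_eq ?abse0// => r _.
    by rewrite /F/= uD// mulr0 normr0.
  rewrite patchE mem_set//.
  have K0 : 0 <= K s by rewrite -lee_fin -kD//; apply: integral_ge0 => r _; rewrite lee_fin mulr_ge0.
  transitivity (\int[mu]_r (`|u s|%:E * (k (s, r) * \1_D r)%:E))%E.
    apply: eq_integral => r _; rewrite /F/= uD1// normrM mulrC EFinM.
    by rewrite (ger0_norm (mulr_ge0 _ _)).
  rewrite ge0_integralZl_EFin//.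
  - by rewrite kD// -EFinM /= normrM mulrC (ger0_norm K0).
  - by move=> r _; rewrite lee_fin mulr_ge0.
  - by apply/measurable_EFinP; exact: mk1.
have Fi : (mu \x mu)%E.-integrable setT (EFin \o F).
  apply/integrable12ltyP => //.
  under eq_integral do rewrite inner_abs.
  by have /integrable_mkcond := iK => /(_ mD)/integrableP[].
have inner1 s : (\int[mu]_r (EFin \o F) (s, r) = ((fun s => (K s * u s)%:E) \_ D) s)%E.
  have [Ds|nDs] := pselect (D s); last first.
    rewrite patchE ifF; last by apply/negbTE; rewrite notin_setE.
    by rewrite integral0_eq// => r _; rewrite /F/= uD// mulr0.
  rewrite patchE mem_set//.
  transitivity (\int[mu]_r ((u s)%:E * (k (s, r) * \1_D r)%:E))%E.
    by apply: eq_integral => r _; rewrite /F/= uD1// mulrC EFinM.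
  by rewrite integralZl// ?kD// -?EFinM 1?mulrC//; exact: kDi.
have inner2 r : (\int[mu]_s (EFin \o F) (s, r) =
    ((fun r => (\int[mu]_(s in D) (k (s, r) * u s))%:E) \_ D) r)%E.
  have [Dr|nDr] := pselect (D r); last first.
    rewrite patchE ifF; last by apply/negbTE; rewrite notin_setE.
    rewrite integral0_eq// => s _; rewrite /F/= indicE memNset//=.
    by rewrite mulr0 mul0r.
  rewrite patchE mem_set// fineK; last exact: integrable_fin_num (ik _ Dr).
  rewrite [RHS]integral_mkcond; apply: eq_integral => s _.
  rewrite /F/= indicE mem_set// mulr1 !patchE; case: ifP => // _.
  by rewrite mulr0.
have := Fubini Fi.
under eq_integral do rewrite inner1.
under [X in _ = X -> _]eq_integral do rewrite inner2.
rewrite -!integral_mkcond => FE; split; last by rewrite /Rintegral FE.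
apply/integrable_mkcond => //.
apply: (@eq_integrable _ _ _ mu setT measurableT (fubini_G mu (EFin \o F))).
  by move=> r _; rewrite /fubini_G inner2.
have mG := measurable_fubini_G Fi.
have maF : measurable_fun setT (abse \o (EFin \o F)) by exact: measurableT_comp.
apply/integrableP; split => //.
apply: le_lt_trans ((integrable21ltyP mu mu mF).1 Fi).
apply: ge0_le_integral => //.
- exact: measurableT_comp.
- apply: (measurable_fun_fubini_tonelli_G _ maF) => p; exact: abse_ge0.
- move=> r _; apply: le_abse_integral => //.
  apply: (measurableT_comp mF); exact: pair2_measurable.
Qed.

Lemma integrable_mulrl (R : realType) (D : set (measurableTypeR R)) (c : R) (f : R -> R) :
  measurable D -> lebesgue_measure.-integrable D (EFin \o f) ->
  lebesgue_measure.-integrable D (EFin \o (fun x => c * f x)).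
Proof. by move=> mD fi; exact: (integrableZl mD c fi). Qed.

(** Cuts the domain down to the section on which a triangular kernel is nonzero. *)
Lemma Rintegral_restrict_eq (R : realType) (D E : set (measurableTypeR R)) (f g : R -> R) :
  measurable D -> measurable E -> f \_ D = g \_ E ->
  (lebesgue_measure.-integrable E (EFin \o g) ->
   lebesgue_measure.-integrable D (EFin \o f)) /\
  \int[lebesgue_measure]_(x in D) f x = \int[lebesgue_measure]_(x in E) g x.
Proof.
move=> mD mE fg; split; last by rewrite Rintegral_mkcond [RHS]Rintegral_mkcond fg.
move=> gi; apply: ((integrable_mkcond (mu := @lebesgue_measure R) (EFin \o f) mD).2 _).
rewrite restrict_EFin fg -restrict_EFin.
exact: ((integrable_mkcond (mu := @lebesgue_measure R) (EFin \o g) mE).1 gi).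
Qed.

(** * The Volterra equation and integration by parts *)

(* y is the integral of u, and its Caputo derivative of order al is g on ]a, b].
   Unlike caputo_solution, this is stable under change of sign, because u is
   not required to be derive1 y. *)
Definition caputo_abel (R : realType) (a b al : R) (u y g : R -> R) : Prop :=
  [/\ lebesgue_measure.-integrable `[a, b] (EFin \o u),
      forall t, a <= t <= b -> y t = y a + \int[lebesgue_measure]_(s in `[a, t]) u s,
      forall t, a < t <= b -> lebesgue_measure.-integrable `[a, t]
                                (fun s => ((t - s) `^ (- al) * u s)%:E) &
      forall t, a < t <= b -> \int[lebesgue_measure]_(s in `[a, t]) ((t - s) `^ (- al) * u s)
                              = Gamma (1 - al) * g t].

Section caputo_abel.
Context (R : realType) (a b al : R) (u y g : R -> R).
Hypotheses (al01 : 0 < al < 1) (sol : caputo_abel a b al u y g).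

Lemma caputo_abel_increment r t : a <= r -> r <= t -> t <= b ->
  \int[lebesgue_measure]_(s in `]r, t[) u s = y t - y r.
Proof.
move=> ar rt tb; have [ui yE _ _] := sol.
have uit : lebesgue_measure.-integrable `[a, t] (EFin \o u).
  by apply: integrableS ui => //; apply: subset_itvl; rewrite bnd_simp.
have uirt : lebesgue_measure.-integrable `]r, t[ (EFin \o u).
  by apply: integrableS uit => //; apply: subset_itv; rewrite bnd_simp.
rewrite Rintegral_itv_bndo_bndc//.
rewrite -(Rintegral_itvB uit) ?bnd_simp// yE; last lra.
by rewrite [y r]yE; [ring|lra].
Qed.

Lemma caputo_abel_continuous : a <= b -> {within `[a, b], continuous y}.
Proof.
move=> ab; have [ui yE _ _] := sol.
have h := parameterized_integral_continuous ab ui.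
apply: (@subspace_eq_continuous _ _ _
  ((fun t => y a + \int[lebesgue_measure]_(s in `[a, t]) u s) : subspace `[a, b] -> R)).
  by move=> t /set_mem; rewrite /= in_itv/= => tab; rewrite -yE.
by move=> t; apply: cvgD; [exact: cvg_cst|exact: h].
Qed.

(* Fubini for (t - r)^(al - 1) (r - s)^(- al) u(s) on a < s < r < t. *)
Lemma volterra t : a < t <= b ->
  lebesgue_measure.-integrable `]a, t[ (fun r => ((t - r) `^ (al - 1) * g r)%:E) /\
  beta_const (1 - al) * (y t - y a) =
    Gamma (1 - al) * \int[lebesgue_measure]_(r in `]a, t[) ((t - r) `^ (al - 1) * g r).
Proof.
move=> /andP[at_ tb]; have [ui yE ki kE] := sol; have [al0 al1] := andP al01.
pose mu := @lebesgue_measure R; pose z := 1 - al.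
have z01 : 0 < z < 1 by rewrite /z; lra.
(* The triangle s < r is built into the kernel, since [powR] does not vanish on negative bases. *)
pose k (p : R * R) : R :=
  if p.1 < p.2 then (t - p.2) `^ (- z) * (p.2 - p.1) `^ (z - 1) else 0.
have uit : mu.-integrable `]a, t[ (EFin \o u).
  by apply: integrableS ui => //; apply: subset_itv; rewrite bnd_simp// ltW.
have mk : measurable_fun setT k.
  apply: measurable_fun_ifT => //; first exact: measurable_fun_ltr.
  apply: measurable_funM.
    rewrite (_ : (fun _ => _) = (fun x => (t - x) `^ (- z)) \o snd)//.
    by apply: measurableT_comp => //; exact: measurable_powRBl.
  rewrite (_ : (fun _ => _) = (@powR R ^~ (z - 1)) \o (fun p : R * R => p.2 - p.1))//.
  by apply: measurableT_comp; [exact: measurable_powR|exact: measurable_funB].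
have k0 p : 0 <= k p by rewrite /k; case: ifP => // _; rewrite mulr_ge0 ?powR_ge0.
have kK s : `]a, t[%classic s -> (\int[mu]_(r in `]a, t[) (k (s, r))%:E = (beta_const z)%:E)%E.
  rewrite /= in_itv/= => /andP[as_ st].
  rewrite -(integral_beta_kernel z01 st) integral_mkcond [RHS]integral_mkcond.
  apply: eq_integral => r _; rewrite !patchE /k/=.
  have [sr|rs] := ltP s r.
    rewrite (_ : (r \in `]a, t[%classic) = (r \in `]s, t[%classic))//.
    by rewrite !mem_setE !in_itv/= sr (lt_trans as_ sr).
  by rewrite !mem_setE !in_itv/= [s < r]ltNge rs/=; case: ifP.
have inner r : `]a, t[%classic r ->
    mu.-integrable `]a, t[ (fun s => (k (s, r) * u s)%:E) /\
    \int[mu]_(s in `]a, t[) (k (s, r) * u s) = (t - r) `^ (- z) * (Gamma z * g r).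
  rewrite /= in_itv/= => /andP[ar rt].
  have rab : a < r <= b by lra.
  have kir : mu.-integrable `]a, r[ (EFin \o (fun s => (r - s) `^ (- al) * u s)).
    by apply: integrableS (ki _ rab) => //; apply: subset_itv; rewrite bnd_simp.
  have E : (fun s => k (s, r) * u s) \_ `]a, t[ =
      (fun s => (t - r) `^ (- z) * ((r - s) `^ (- al) * u s)) \_ `]a, r[.
    apply/funext => s; rewrite !patchE !mem_setE !in_itv/= /k/=.
    have [sr|rs] := ltP s r; last by rewrite mul0r andbF; case: ifP.
    rewrite (lt_trans sr rt) mulrA (_ : z - 1 = - al)//.
    by rewrite /z; ring.
  have [Ei EI] := Rintegral_restrict_eq (measurable_itv _) (measurable_itv _) E.
  split.
    apply: Ei; exact: (integrable_mulrl ((t - r) `^ (- z)) _ kir).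
  rewrite EI RintegralZl// -(kE _ rab); congr (_ * _).
  rewrite Rintegral_itv_bndo_bndc//.
  apply: Rintegral_itv_obnd_cbnd.
  by apply: integrableS (ki _ rab) => //; apply: subset_itvr; rewrite bnd_simp.
have iK : mu.-integrable `]a, t[ (fun s => (beta_const z * u s)%:E).
  exact: (integrable_mulrl (beta_const z) _ uit).
have mut : measurable_fun `]a, t[ u.
  by apply/measurable_EFinP; exact: measurable_int uit.
have [] := @kernel_fubini R `]a, t[ u (fun=> beta_const z) k (measurable_itv _)
   mut mk k0 kK iK (fun r Dr => (inner r Dr).1).
rewrite -/mu => Ki KE.
have IE : \int[mu]_(r in `]a, t[) \int[mu]_(s in `]a, t[) (k (s, r) * u s) =
    \int[mu]_(r in `]a, t[) (Gamma z * ((t - r) `^ (al - 1) * g r)).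
  apply: eq_Rintegral => r /set_mem ra; rewrite (inner r ra).2 mulrCA.
  by rewrite (_ : - z = al - 1)//; rewrite /z; ring.
have z0 : Gamma z != 0.
  have [] := andP z01 => z0 z1.
  have /andP[] := Gamma_bounds z01; have [->|//] := eqVneq (Gamma z) 0.
  by rewrite mulr0 subr_le0 leNgt z1.
(* Integrability of the Volterra integrand is an output of Fubini: up to the factor [Gamma z], it is
   the inner integral. *)
have i1 : mu.-integrable `]a, t[ (EFin \o (fun r => (t - r) `^ (al - 1) * g r)).
  have := integrable_mulrl (Gamma z)^-1 (measurable_itv _) Ki.
  apply: eq_integrable => // r ra; rewrite /= (inner r (set_mem ra)).2.
  congr (_%:E); rewrite (_ : - z = al - 1); last by rewrite /z; ring.
  by rewrite mulrCA mulKf.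
split=> //; rewrite -/mu -RintegralZl// -IE -KE RintegralZl//.
by rewrite caputo_abel_increment// ltW.
Qed.

(* Fubini for al (t - r)^(- al - 1) u(s) on a < r < s < t. *)
Lemma caputo_abel_by_parts t : a < t <= b ->
  lebesgue_measure.-integrable `]a, t[
    (fun r => (al * (t - r) `^ (- al - 1) * (y t - y r))%:E) /\
  Gamma (1 - al) * g t = (t - a) `^ (- al) * (y t - y a) +
    \int[lebesgue_measure]_(r in `]a, t[) (al * (t - r) `^ (- al - 1) * (y t - y r)).
Proof.
move=> /andP[at_ tb]; have [ui yE ki kE] := sol; have [al0 al1] := andP al01.
have tab : a < t <= b by lra.
pose mu := @lebesgue_measure R.
pose k (p : R * R) : R := if p.2 < p.1 then al * (t - p.2) `^ (- al - 1) else 0.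
(* K s is the integral of al (t - r)^(- al - 1) over a < r < s; its constant term produces the
   boundary term at a. *)
pose K s : R := (t - s) `^ (- al) - (t - a) `^ (- al).
have uit : mu.-integrable `]a, t[ (EFin \o u).
  by apply: integrableS ui => //; apply: subset_itv; rewrite bnd_simp// ltW.
have kit : mu.-integrable `]a, t[ (EFin \o (fun s => (t - s) `^ (- al) * u s)).
  by apply: integrableS (ki _ tab) => //; apply: subset_itv; rewrite bnd_simp.
have mk : measurable_fun setT k.
  apply: measurable_fun_ifT => //; first exact: measurable_fun_ltr.
  apply: measurable_funM => //.
  rewrite (_ : (fun _ => _) = (fun x => (t - x) `^ (- al - 1)) \o snd)//.
  by apply: measurableT_comp => //; exact: measurable_powRBl.
have k0 p : 0 <= k p by rewrite /k; case: ifP => // _; rewrite mulr_ge0 ?powR_ge0// ltW.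
have kK s : `]a, t[%classic s -> (\int[mu]_(r in `]a, t[) (k (s, r))%:E = (K s)%:E)%E.
  rewrite /= in_itv/= => /andP[as_ st].
  transitivity (\int[mu]_(r in `]a, s[) (al%:E * ((t - r) `^ (- al - 1))%:E))%E.
    rewrite integral_mkcond [RHS]integral_mkcond.
    apply: eq_integral => r _; rewrite !patchE !mem_setE !in_itv/= /k/=.
    have [rs|sr] := ltP r s; last by rewrite andbF; case: ifP.
    by rewrite (lt_trans rs st) EFinM.
  rewrite ge0_integralZl_EFin//; last first.
  - exact: ltW.
  - by apply/measurable_EFinP; exact: measurable_powRBl.
  - by move=> x _; rewrite lee_fin powR_ge0.
  rewrite integral_powRBl//; [|by rewrite oppr_eq0 gt_eqF|exact: ltW|by rewrite st orbT].
  by rewrite -EFinM; congr (_%:E); rewrite /K; field; rewrite gt_eqF.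
have inner r : `]a, t[%classic r ->
    mu.-integrable `]a, t[ (fun s => (k (s, r) * u s)%:E) /\
    \int[mu]_(s in `]a, t[) (k (s, r) * u s) = al * (t - r) `^ (- al - 1) * (y t - y r).
  rewrite /= in_itv/= => /andP[ar rt].
  have uir : mu.-integrable `]r, t[ (EFin \o u).
    by apply: integrableS uit => //; apply: subset_itvr; rewrite bnd_simp ltW.
  have E : (fun s => k (s, r) * u s) \_ `]a, t[ =
      (fun s => al * (t - r) `^ (- al - 1) * u s) \_ `]r, t[.
    apply/funext => s; rewrite !patchE !mem_setE !in_itv/= /k/=.
    have [rs|sr] := ltP r s; last by rewrite mul0r; case: ifP.
    by rewrite (lt_trans ar rs).
  have [Ei EI] := Rintegral_restrict_eq (measurable_itv _) (measurable_itv _) E.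
  split.
    apply: Ei; exact: (integrable_mulrl (al * (t - r) `^ (- al - 1)) _ uir).
  by rewrite EI RintegralZl// caputo_abel_increment// ltW.
have KE s : K s * u s = (t - s) `^ (- al) * u s - (t - a) `^ (- al) * u s.
  by rewrite /K; ring.
have aui : mu.-integrable `]a, t[ (EFin \o (fun s => (t - a) `^ (- al) * u s)).
  exact: (integrable_mulrl ((t - a) `^ (- al)) _ uit).
have iK : mu.-integrable `]a, t[ (fun s => (K s * u s)%:E).
  apply: eq_integrable (integrableB _ kit aui) => //.
  by move=> s _; rewrite KE EFinB.
have mut : measurable_fun `]a, t[ u.
  by apply/measurable_EFinP; exact: measurable_int uit.
have [] := @kernel_fubini R `]a, t[ u K k (measurable_itv _)
   mut mk k0 kK iK (fun r Dr => (inner r Dr).1).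
rewrite -/mu => Ki KI.
have IE : \int[mu]_(r in `]a, t[) \int[mu]_(s in `]a, t[) (k (s, r) * u s) =
    \int[mu]_(r in `]a, t[) (al * (t - r) `^ (- al - 1) * (y t - y r)).
  by apply: eq_Rintegral => r /set_mem ra; rewrite (inner r ra).2.
split.
  by apply: eq_integrable Ki => // r ra; rewrite (inner r (set_mem ra)).2.
rewrite -/mu -IE -KI.
under eq_Rintegral do rewrite KE.
rewrite RintegralB// RintegralZl// caputo_abel_increment//; last exact: ltW.
rewrite (_ : \int[mu]_(x in `]a, t[) ((t - x) `^ (- al) * u x) = Gamma (1 - al) * g t).
  by ring.
rewrite -(kE _ tab) Rintegral_itv_bndo_bndc//.
apply: Rintegral_itv_obnd_cbnd.
by apply: integrableS (ki _ tab) => //; apply: subset_itvr; rewrite bnd_simp.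
Qed.

End caputo_abel.

(** * Quantitative estimates drawn from the two identities *)

Lemma Gamma_gt0 (R : realType) (z : R) : 0 < z < 1 -> 0 < Gamma z.
Proof.
move=> /[dup] z01 /Gamma_bounds /andP[h _]; have [z0 z1] := andP z01.
by rewrite -(pmulr_rgt0 _ z0); apply: lt_le_trans h; rewrite subr_gt0.
Qed.

Lemma beta_const_gt0 (R : realType) (z : R) : 0 < z < 1 -> 0 < beta_const z.
Proof.
move=> /[dup] z01 /beta_const_bounds [_ /andP[h _]]; have [z0 z1] := andP z01.
by rewrite -(pmulr_rgt0 _ z0); apply: lt_le_trans h.
Qed.

Lemma Rintegral_powRBl (R : realType) (p c d t : R) (b1 b2 : bool) : p != 0 ->
  c < d -> d <= t -> (0 < p) || (d < t) ->
  lebesgue_measure.-integrable [set` Interval (BSide b1 c) (BSide b2 d)]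
    (EFin \o (fun s => (t - s) `^ (p - 1))) /\
  \int[lebesgue_measure]_(s in [set` Interval (BSide b1 c) (BSide b2 d)])
     ((t - s) `^ (p - 1)) = ((t - c) `^ p - (t - d) `^ p) / p.
Proof.
move=> p0 cd dt pd; have IE := integral_powRBl b1 b2 p0 cd dt pd.
split; last by rewrite /Rintegral IE.
apply/integrableP; split; first by apply/measurable_EFinP; exact: measurable_powRBl.
under eq_integral => s _ do rewrite /= ger0_norm ?powR_ge0//.
by rewrite IE ltry.
Qed.

Lemma le_Rintegral_weight (R : realType) (D : set (measurableTypeR R)) (w h : R -> R) (c : R) :
  measurable D -> lebesgue_measure.-integrable D (EFin \o w) ->
  lebesgue_measure.-integrable D (EFin \o (fun r => w r * h r)) ->
  (forall r, D r -> 0 <= w r /\ c <= h r) ->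
  c * \int[lebesgue_measure]_(r in D) w r <= \int[lebesgue_measure]_(r in D) (w r * h r).
Proof.
move=> mD wi whi wh; rewrite -RintegralZl//; apply: le_Rintegral => //.
  exact: integrable_mulrl.
by move=> r /wh[w0 ch]; rewrite mulrC ler_wpM2l.
Qed.

Lemma norm_Rintegral_weight (R : realType) (D : set (measurableTypeR R)) (w h : R -> R) (c : R) :
  measurable D -> lebesgue_measure.-integrable D (EFin \o w) ->
  lebesgue_measure.-integrable D (EFin \o (fun r => w r * h r)) ->
  (forall r, D r -> 0 <= w r /\ `|h r| <= c) ->
  `|\int[lebesgue_measure]_(r in D) (w r * h r)| <= c * \int[lebesgue_measure]_(r in D) w r.
Proof.
move=> mD wi whi wh; rewrite ler_norml; apply/andP; split.
  rewrite -mulNr; apply: le_Rintegral_weight => // r /wh[w0].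
  by rewrite ler_norml => /andP[].
rewrite -RintegralZl//; apply: le_Rintegral => //.
  exact: integrable_mulrl.
by move=> r /wh[w0]; rewrite ler_norml => /andP[_ hc]; rewrite mulrC ler_wpM2r.
Qed.

Section caputo_abel_estimates.
Context (R : realType) (a b al : R) (u y g : R -> R).
Hypotheses (al01 : 0 < al < 1) (sol : caputo_abel a b al u y g).
Let mu := @lebesgue_measure R.
Let G := Gamma (1 - al).
Let B := beta_const (1 - al).

Lemma Rintegral_split_oo (f : R -> R) (t x : R) : a <= t -> t < x ->
  mu.-integrable `]a, x[ (EFin \o f) ->
  \int[mu]_(r in `]a, x[) f r = \int[mu]_(r in `]a, t[) f r + \int[mu]_(r in `]t, x[) f r.
Proof.
move=> at_ tx fi.
have := @Rintegral_itvB R f (BRight a) (BLeft x) t fi.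
rewrite !bnd_simp => /(_ at_ tx) <-.
rewrite (@Rintegral_itv_bndo_bndc R (BRight a) t); first by ring.
by apply: integrableS fi => //; apply: subset_itvl; rewrite bnd_simp ltW.
Qed.

(** Difference of the Volterra equations at x and t. On ]t,
    x[, g is replaced by l at cost eta. On ]a, t[ the difference of kernels is nonnegative because
    al < 1, and its integral is the factor of M, which vanishes in the limit al = 1. *)
Lemma caputo_abel_estimate (t x l eta M : R) : a <= t -> t < x -> x <= b ->
  (forall r, t < r < x -> `|g r - l| <= eta) ->
  (forall r, a < r < x -> `|g r| <= M) ->
  `|B * (y x - y t) - G * (l * ((x - t) `^ al / al))| <=
    G * (eta * ((x - t) `^ al / al) +
         M * (((t - a) `^ al - (x - a) `^ al + (x - t) `^ al) / al)).
Proof.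
move=> at_ tx xb gl gM; have [al0 al1] := andP al01.
have alg (k p q r : R) : k * (p + q) - k * r - k * q = - (k * (r - p)) by ring.
have z01 : 0 < 1 - al < 1 by apply/andP; split; lra.
have G0 : 0 < G := Gamma_gt0 z01.
have aln0 : al != 0 by rewrite gt_eqF.
have axb : a < x <= b by rewrite (le_lt_trans at_ tx).
have [xi xE] := volterra al01 sol axb.
have xti : mu.-integrable `]t, x[ (EFin \o (fun r => (x - r) `^ (al - 1) * g r)).
  by apply: integrableS xi => //; apply: subset_itvr; rewrite bnd_simp.
have [wi wE] := Rintegral_powRBl false true aln0 tx (lexx x) (introT orP (or_introl al0)).
rewrite subrr powR0// subr0 in wE.
have J1 : `|\int[mu]_(r in `]t, x[) ((x - r) `^ (al - 1) * g r) - l * ((x - t) `^ al / al)|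
     <= eta * ((x - t) `^ al / al).
  have wli := integrable_mulrl l (measurable_itv _) wi.
  rewrite -wE -RintegralZl// -RintegralB//.
  under eq_Rintegral do rewrite [l * _]mulrC -mulrBr.
  apply: norm_Rintegral_weight => //.
    apply: eq_integrable (integrableB _ xti wli) => //.
    by move=> r _; rewrite -EFinB /= [l * _]mulrC -mulrBr.
  by move=> r; rewrite /= in_itv/= => rt; rewrite powR_ge0 gl.
have J2 : `|B * (y x - y t) - G * \int[mu]_(r in `]t, x[) ((x - r) `^ (al - 1) * g r)|
   <= G * (M * (((t - a) `^ al - (x - a) `^ al + (x - t) `^ al) / al)).
  (* For t = a, where [volterra] does not apply, there is no memory term and both sides are 0. *)
  have [ta|nta] := ltP a t; last first.
    have <- : a = t by apply/eqP; rewrite eq_le at_ nta.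
    by rewrite xE subrr normr0 subrr powR0// sub0r addNr mul0r !mulr0.
  have atb : a < t <= b by rewrite ta (le_trans (ltW tx) xb).
  have [ti tE] := volterra al01 sol atb.
  have xai : mu.-integrable `]a, t[ (EFin \o (fun r => (x - r) `^ (al - 1) * g r)).
    by apply: integrableS xi => //; apply: subset_itvl; rewrite bnd_simp ltW.
  have [w1i w1E] := Rintegral_powRBl false true aln0 ta (lexx t) (introT orP (or_introl al0)).
  have [w2i w2E] := Rintegral_powRBl false true aln0 ta (ltW tx) (introT orP (or_introl al0)).
  rewrite subrr powR0// subr0 in w1E.
  have -> : B * (y x - y t) - G * \int[mu]_(r in `]t, x[) ((x - r) `^ (al - 1) * g r) =
     - (G * \int[mu]_(r in `]a, t[) (((t - r) `^ (al - 1) - (x - r) `^ (al - 1)) * g r)).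
    rewrite (_ : B * _ = B * (y x - y a) - B * (y t - y a)); last ring.
    rewrite xE tE (Rintegral_split_oo at_ tx xi).
    under [in RHS]eq_Rintegral do rewrite mulrBl.
    by rewrite RintegralB//; exact: alg.
  rewrite normrN normrM (gtr0_norm G0) ler_pM2l//.
  have w12i : mu.-integrable `]a, t[
      (EFin \o (fun r => (t - r) `^ (al - 1) - (x - r) `^ (al - 1))).
    by apply: eq_integrable (integrableB _ w1i w2i) => // r _; rewrite -EFinB.
  have -> : ((t - a) `^ al - (x - a) `^ al + (x - t) `^ al) / al =
     \int[mu]_(r in `]a, t[) ((t - r) `^ (al - 1) - (x - r) `^ (al - 1)).
    by rewrite RintegralB// w1E w2E; field.
  apply: norm_Rintegral_weight => //.
    apply: eq_integrable (integrableB _ ti xai) => //.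
    by move=> r _; rewrite -EFinB /= -mulrBl.
  move=> r; rewrite /= in_itv/= => /andP[ar rt]; split; last first.
    by apply: gM; rewrite ar (lt_trans rt tx).
  rewrite subr_ge0 (_ : al - 1 = - (1 - al)); last ring.
  apply: ler_powRN; first by case/andP: z01 => /ltW.
    by rewrite subr_gt0.
  by rewrite lerD2r ltW.
set P := \int[mu]_(r in `]t, x[) _ in J1 J2.
rewrite (_ : _ - _ = (B * (y x - y t) - G * P) + G * (P - l * ((x - t) `^ al / al))); last ring.
rewrite [leRHS]mulrDr [leRHS]addrC; apply: (le_trans (ler_normD _ _)); apply: lerD => //.
by rewrite normrM (gtr0_norm G0) ler_pM2l.
Qed.

(** The previous estimate with l = 0 and eta = M, dropping the nonpositive (t - a)^al - (x - a)^al.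
    The constant 8 is a factor 2 from G <= 2 B times two terms with 1 / al <= 2; the exponent 1/2
    serves all al >= 1/2 because x - t <= 1. *)
Lemma caputo_abel_holder (t x M : R) : 2^-1 <= al -> a <= t -> t < x -> x <= b -> x - t <= 1 ->
  (forall r, a < r < x -> `|g r| <= M) ->
  `|y x - y t| <= 8 * M * (x - t) `^ 2^-1.
Proof.
move=> al2 at_ tx xb xt1 gM; have [al0 al1] := andP al01.
have z01 : 0 < 1 - al < 1 by apply/andP; split; lra.
have G0 : 0 < G := Gamma_gt0 z01.
have B0 : 0 < B := beta_const_gt0 z01.
have GB : G <= 2 * B.
  have /andP[_ h1] := Gamma_bounds z01.
  have [_ /andP[h2 _]] := beta_const_bounds z01.
  have [z0 z1] := andP z01.
  rewrite -/G in h1; rewrite -/B in h2.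
  rewrite -(ler_pM2l z0) (_ : (1 - al) * (2 * B) = 2 * ((1 - al) * B)); last ring.
  apply: (le_trans h1); apply: (@le_trans _ _ (2 * 1)); last by rewrite ler_pM2l.
  by rewrite mulr1; lra.
have M0 : 0 <= M.
  apply: le_trans (normr_ge0 _) (gM ((t + x) / 2) _).
  by apply/andP; split; lra.
have gM0 r : t < r < x -> `|g r - 0| <= M.
  by move=> /andP[tr rx]; rewrite subr0; apply: gM; rewrite rx (le_lt_trans at_ tr).
have := caputo_abel_estimate at_ tx xb gM0 gM.
rewrite mul0r mulr0 subr0 normrM (gtr0_norm B0).
have tal0 := powR_ge0 (x - t) al.
have tax : (t - a) `^ al <= (x - a) `^ al.
  by apply: ge0_ler_powR; rewrite ?nnegrE; lra.
have tal : (x - t) `^ al <= (x - t) `^ 2^-1 by apply: ger_powR; lra.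
have ial : al^-1 <= 2 by rewrite invf_ple ?posrE.
set p := (x - t) `^ al in tal0 tal *; set q := (x - t) `^ 2^-1 in tal *.
set p1 := (t - a) `^ al in tax *; set p2 := (x - a) `^ al in tax *.
move=> h; rewrite -(ler_pM2l B0); apply: (le_trans h).
have h1 : M * (p / al) + M * ((p1 - p2 + p) / al) <= M * (p * 4).
  rewrite -mulrDr ler_wpM2l// -mulrDl ler_pdivrMr//; nra.
have h2 : M * (p * 4) <= M * (q * 4) by rewrite ler_wpM2l// ler_pM2r.
have Mq : 0 <= M * (q * 4) by rewrite !mulr_ge0// (le_trans tal0).
apply: (@le_trans _ _ (G * (M * (q * 4)))); first by rewrite ler_pM2l// (le_trans h1).
apply: (@le_trans _ _ (2 * B * (M * (q * 4)))); first by rewrite ler_wpM2r.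
by rewrite (_ : 2 * B * _ = B * (8 * M * q))//; ring.
Qed.

(* Applied when y reaches at time t, from below, a line of slope A starting at
   T0: for al close to 1 the left-hand side is about A * Gamma (1 - al). *)
Lemma caputo_abel_touch (t T0 A C : R) : a < T0 -> T0 < t -> t <= b -> 0 <= C ->
  (forall r, T0 < r < t -> A * (t - r) <= y t - y r) ->
  (forall r, a <= r <= T0 -> - C <= y t - y r) ->
  al * A * ((t - T0) `^ (1 - al) / (1 - al)) - C * (t - T0) `^ (- al) <= G * g t.
Proof.
move=> aT Tt tb C0 hA hC; have [al0 al1] := andP al01.
have atb : a < t <= b by rewrite (lt_trans aT Tt).
have [ii ->] := caputo_abel_by_parts al01 sol atb.
have naln0 : - al != 0 by rewrite oppr_eq0 gt_eqF.
have z0 : 0 < 1 - al by rewrite subr_gt0.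
rewrite (Rintegral_split_oo (ltW aT) Tt ii).
have ii1 : mu.-integrable `]a, T0[ (EFin \o (fun r => al * (t - r) `^ (- al - 1) * (y t - y r))).
  by apply: integrableS ii => //; apply: subset_itvl; rewrite bnd_simp ltW.
have ii2 : mu.-integrable `]T0, t[ (EFin \o (fun r => al * (t - r) `^ (- al - 1) * (y t - y r))).
  by apply: integrableS ii => //; apply: subset_itvr; rewrite bnd_simp ltW.
have h1 : - C * ((t - T0) `^ (- al) - (t - a) `^ (- al)) <=
    \int[mu]_(r in `]a, T0[) (al * (t - r) `^ (- al - 1) * (y t - y r)).
  have [wi wE] := Rintegral_powRBl false true naln0 aT (ltW Tt) (introT orP (or_intror Tt)).
  have <- : \int[mu]_(r in `]a, T0[) (al * (t - r) `^ (- al - 1)) =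
     (t - T0) `^ (- al) - (t - a) `^ (- al).
    by rewrite RintegralZl// wE; field; rewrite gt_eqF.
  apply: le_Rintegral_weight => //; first exact: integrable_mulrl.
  move=> r; rewrite /= in_itv/= => /andP[ar rT]; split; last by apply: hC; rewrite !ltW.
  by rewrite mulr_ge0 ?powR_ge0// ltW.
have h2 : al * A * ((t - T0) `^ (1 - al) / (1 - al)) <=
    \int[mu]_(r in `]T0, t[) (al * (t - r) `^ (- al - 1) * (y t - y r)).
  have [wi wE] := Rintegral_powRBl false true (lt0r_neq0 z0) Tt (lexx t) (introT orP (or_introl z0)).
  rewrite subrr powR0 ?gt_eqF// subr0 in wE.
  rewrite -wE -RintegralZl//; apply: le_Rintegral => //; first exact: integrable_mulrl.
  move=> r; rewrite /= in_itv/= => rTt; have [Tr rt] := andP rTt.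
  have tr0 : 0 < t - r by rewrite subr_gt0.
  (* The linear lower bound on y t - y r supplies one power of t - r, which makes the kernel
     integrable with integral of order 1 / (1 - al). *)
  rewrite (_ : (t - r) `^ (1 - al - 1) = (t - r) * (t - r) `^ (- al - 1)); last first.
    rewrite -[X in X * _](powRr1 (ltW tr0)) -powRD; last first.
      by apply/implyP => _; rewrite gt_eqF.
    by congr (_ `^ _); ring.
  rewrite (_ : al * A * _ = al * (t - r) `^ (- al - 1) * (A * (t - r))); last ring.
  by rewrite ler_wpM2l ?hA// mulr_ge0 ?powR_ge0 ?ltW.
(* The (t - a)^(- al) terms of [h1] and [h3] cancel, leaving only - C (t - T0)^(- al). *)
have h3 : - C * (t - a) `^ (- al) <= (t - a) `^ (- al) * (y t - y a).
  by rewrite mulrC ler_wpM2l ?powR_ge0// hC// lexx ltW.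
by lra.
Qed.

End caputo_abel_estimates.

(** * First crossing times and the line barrier *)

Lemma within_continuous_eps (R : realType) (A : set R) (w : R -> R) (t e : R) :
  {within A, continuous w} -> A t -> 0 < e ->
  exists2 d, 0 < d & forall s, A s -> `|t - s| < d -> `|w t - w s| < e.
Proof.
move=> /subspace_continuousP/(_ t) cw At e0.
have /cvgrPdist_lt/(_ e e0) := cw At.
rewrite near_withinE => /nbhs_ballP[d d0 dw]; exists d => // s As ts.
exact: (dw s ts As).
Qed.

(** Take the infimum of the points where w is nonnegative: continuity excludes w < 0 there by nearby
    points of the set, and w > 0 by points just before. *)
Lemma first_zero (R : realType) (w : R -> R) (p q t0 : R) :
  {within `[p, q], continuous w} -> w p < 0 -> p <= t0 <= q -> 0 <= w t0 ->
  exists t, [/\ p < t <= q, w t = 0 & forall s, p <= s < t -> w s < 0].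
Proof.
move=> cw wp pt0 wt0.
pose S := [set s | p <= s <= q /\ 0 <= w s].
have S0 : S t0 by [].
have hS : has_inf S.
  by split; [exists t0|exists p => s [/andP[ps _] _]].
have lbS s : S s -> inf S <= s by move=> Ss; apply: ge_inf => //; case: hS.
pose t := inf S.
have pt : p <= t by apply: lb_le_inf; [exists t0|move=> s [/andP[]]].
have tq : t <= q by apply: le_trans (lbS _ S0) _; case/andP: pt0.
have tI : `[p, q]%classic t by rewrite /= in_itv/= pt tq.
have below s : p <= s < t -> w s < 0.
  move=> /andP[ps st]; rewrite ltNge; apply/negP => ws.
  have : t <= s by apply: lbS; split => //; rewrite ps (le_trans (ltW st)).
  by rewrite leNgt st.
have wt_ge : 0 <= w t.
  rewrite leNgt; apply/negP => wt.
  have [d d0 dw] := within_continuous_eps cw tI (ltac:(by rewrite oppr_gt0) : 0 < - w t).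
  have [s [/andP[ps sq] ws] std] := inf_adherent d0 hS.
  have ts : t <= s by apply: lbS; split => //; rewrite ps.
  have := dw s _ _; rewrite /= in_itv/= ps sq => /(_ isT) h.
  have {h} := h (ltac:(by rewrite distrC ger0_norm ?subr_ge0// ltrBlDl)).
  by rewrite ltr_norml => /andP[]; lra.
have ptlt : p < t.
  by rewrite lt_neqAle pt andbT; apply/eqP => pte; move: wt_ge; rewrite -pte leNgt wp.
exists t; split => //; first by rewrite ptlt.
apply/eqP; rewrite eq_le wt_ge andbT leNgt; apply/negP => wt.
have [d d0 dw] := within_continuous_eps cw tI wt.
pose s := Num.max p (t - d / 2).
have st : s < t by rewrite gt_max ptlt/=; lra.
have ps : p <= s by rewrite le_max lexx.
have sd : t - d / 2 <= s by rewrite le_max lexx orbT.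
have ws := below s (ltac:(by rewrite ps st)).
have := dw s _ _; rewrite /= in_itv/= ps (le_trans (ltW st) tq) => /(_ isT) h.
have {h} := h (ltac:(rewrite ger0_norm; lra)).
by rewrite ltr_norml => /andP[_]; lra.
Qed.

Lemma powR_exponent_cvg (R : realType) (c : R) (h : R -> R) (F : set_system R) (l : R) :
  Filter F -> 0 < c -> h x @[x --> F] --> l -> c `^ h x @[x --> F] --> c `^ l.
Proof.
move=> FF c0 hl; rewrite /powR gt_eqF//.
apply: (@cvg_comp _ _ _ (fun x => h x * ln c) expR F (nbhs (l * ln c))).
  by apply: cvgMl.
exact: continuous_expR.
Qed.

Lemma near_left1 (R : realType) : \forall al \near (1 : R)^'-, 2^-1 <= al /\ 0 < al < 1.
Proof.
near=> al; have h : 2^-1 <= al by near: al; apply: nbhs_left_ge; lra.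
have h1 : al < 1 by near: al; exact: nbhs_left_lt.
by split => //; apply/andP; split; lra.
Unshelve. all: by end_near. Qed.

Lemma exists_small_holder (R : realType) (C c e : R) : 0 < c -> 0 < e ->
  exists d, [/\ 0 < d, d <= 1, d < e & C * d `^ 2^-1 < c].
Proof.
move=> c0 e0; near (0 : R)^'+ => d; exists d; split.
- by near: d; exact: nbhs_right_gt.
- by near: d; apply: nbhs_right_le.
- by near: d; exact: nbhs_right_lt.
- near: d.
  have h : C * d `^ 2^-1 @[d --> 0^'+] --> (0 : R).
    rewrite -[X in _ --> X](mulr0 C); apply: cvgM; first exact: cvg_cst.
    by apply: powR_cvg0; rewrite invr_gt0.
  have /cvgrPdist_lt/(_ c c0) := h; apply: filterS => x.
  by rewrite sub0r normrN; apply: le_lt_trans; exact: ler_norm.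
Unshelve. all: by end_near. Qed.

(* The barrier is the line psi through (T0, q) of slope M + 1. *)
Lemma line_barrier (R : realType) (a b al : R) (u y g : R -> R)
    (T0 T1 T2 q M eta C1 : R) : 0 < al < 1 -> caputo_abel a b al u y g ->
  a < T0 -> 0 < eta -> T0 + eta <= T1 -> T2 <= b -> 0 <= M -> 0 <= C1 ->
  (M + 1) * (T2 - T0) < 1 ->
  (forall r, T0 <= r <= T1 -> y r < q) ->
  (forall r, a <= r <= T0 -> y r <= q + C1) ->
  (forall t, a <= t <= b -> q <= y t <= q + 1 -> g t <= M) ->
  (1 + (1 - al)) * M < al * (M + 1) * eta `^ (1 - al) - (1 - al) * (C1 / eta) ->
  forall t, T1 <= t <= T2 -> y t < q + 1.
Proof.
move=> al01 sol aT0 eta0 T0e T2b M0 C10 MT before yC gM hb.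
have [al0 al1] := andP al01.
have z01 : 0 < 1 - al < 1 by rewrite subr_gt0 al1 gtrBl.
have [z0 z1] := andP z01.
have M10 : 0 < M + 1 by rewrite ltr_wpDl.
have T0T1 : T0 < T1 by apply: lt_le_trans T0e; rewrite ltrDl.
pose psi r := q + (M + 1) * (r - T0).
(* Between T0 and T2 the line stays in the strip from q to q + 1, where g is at most M. *)
have psi_q1 r : r <= T2 -> psi r < q + 1.
  move=> rT2; rewrite /psi ltrD2l; apply: le_lt_trans MT.
  by rewrite ler_pM2l// lerD2r.
have psi_q r : T0 <= r -> q <= psi r.
  by move=> T0r; rewrite /psi lerDl mulr_ge0 ?(ltW M10)// subr_ge0.
pose w r := y r - psi r.
move=> t /andP[T1t tT2]; rewrite ltNge; apply/negP => yt.
have T12 : T1 <= T2 := le_trans T1t tT2.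
have ab : a <= b by apply: le_trans T2b; apply: le_trans T12; rewrite ltW// (lt_trans aT0).
have cw : {within `[T1, T2], continuous w}.
  have cy : {within `[T1, T2], continuous y}.
    apply: continuous_subspaceW (caputo_abel_continuous sol ab).
    by apply: subset_itv; rewrite bnd_simp// ltW// (lt_trans aT0).
  have cpsi : continuous psi.
    move=> x; apply: cvgD; first exact: cvg_cst.
    by apply: cvgM; [exact: cvg_cst|apply: cvgB; [exact: cvg_id|exact: cvg_cst]].
  move=> x; apply: cvgB; first exact: cy.
  exact: continuous_subspaceT.
have wT1 : w T1 < 0.
  rewrite /w subr_lt0; apply: lt_le_trans (psi_q _ (ltW T0T1)); apply: before.
  by rewrite lexx ltW.
have w0 : 0 <= w t by rewrite /w subr_ge0 (le_trans _ yt)// ltW// psi_q1.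
have T1tT2 : T1 <= t <= T2 by rewrite T1t.
(* Up to its first contact with the line, y stays below it, which is the situation of
   [caputo_abel_touch] with slope M + 1. *)
have [t1 [/andP[T1t1 t1T2] wt1 wlt]] := first_zero cw wT1 T1tT2 w0.
have yt1 : y t1 = psi t1 by apply/eqP; rewrite -subr_eq0 -/(w t1) wt1.
have T0t1 : T0 < t1 by exact: lt_trans T1t1.
have t1b : t1 <= b by exact: le_trans T2b.
have hA r : T0 < r < t1 -> (M + 1) * (t1 - r) <= y t1 - y r.
  move=> /andP[T0r rt1].
  have yr : y r <= psi r.
    have [rT1|T1r] := leP r T1.
      by apply: le_trans (psi_q _ (ltW T0r)); apply/ltW/before; rewrite (ltW T0r).
    by have := wlt r; rewrite (ltW T1r) rt1 => /(_ isT); rewrite /w subr_lt0 => /ltW.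
  rewrite yt1; apply: le_trans (_ : psi t1 - psi r <= _); last by rewrite lerD2l lerN2.
  by rewrite (_ : psi t1 - psi r = (M + 1) * (t1 - r))// /psi; ring.
have hCr r : a <= r <= T0 -> - C1 <= y t1 - y r.
  move=> /yC yr; rewrite lerBrDr addrC lerBlDr; apply: (le_trans yr).
  by rewrite lerD2r yt1 psi_q// ltW.
have := caputo_abel_touch al01 sol aT0 T0t1 t1b C10 hA hCr.
have G0 := Gamma_gt0 z01.
have /andP[_ GzU] := Gamma_bounds z01.
have fy : g t1 <= M.
  apply: gM; first by rewrite t1b andbT ltW// (lt_trans aT0).
  by rewrite yt1 psi_q ?ltW// psi_q1.
set tau := t1 - T0.
have tau0 : 0 < tau by rewrite subr_gt0.
(* Contact occurs only after T1, hence at least eta after T0; this keeps tau^(- al) bounded. *)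
have etatau : eta <= tau by rewrite /tau lerBrDl; apply: le_trans T0e _; exact: ltW.
have tau1 : tau <= 1.
  have := psi_q1 _ t1T2; rewrite /psi ltrD2l -/tau => h.
  apply: ltW; apply: le_lt_trans h.
  by rewrite ler_peMl ?(ltW tau0)// lerDr.
have p1 : eta `^ (1 - al) <= tau `^ (1 - al).
  by apply: ge0_ler_powR; rewrite ?nnegrE//; exact: ltW.
have p2 : tau `^ (- al) <= eta^-1.
  rewrite powRN lef_pV2 ?posrE ?powR_gt0//; apply: (le_trans etatau).
  by apply: ger1_powR; rewrite ?tau0 ?tau1// ltW.
move=> h.
(* Multiplication by 1 - al makes the coefficients bounded: for al near 1 the left side is about M +
   1 and the right side at most about M, which [hb] forbids. *)
have {}h : al * (M + 1) * tau `^ (1 - al) - (1 - al) * (C1 * tau `^ (- al)) <=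
    ((1 - al) * Gamma (1 - al)) * g t1.
  rewrite -[leRHS]mulrA; move: h; rewrite -(ler_pM2l z0) -/tau; apply: le_trans.
  by rewrite le_eqVlt; apply/orP; left; apply/eqP; field; rewrite gt_eqF.
have h1 : al * (M + 1) * eta `^ (1 - al) <= al * (M + 1) * tau `^ (1 - al).
  by rewrite ler_wpM2l// mulr_ge0 ?addr_ge0// ltW.
have h2 : (1 - al) * (C1 * tau `^ (- al)) <= (1 - al) * (C1 / eta).
  by rewrite ler_pM2l// ler_wpM2l.
have h3 : (1 - al) * Gamma (1 - al) * g t1 <= (1 + (1 - al)) * M.
  apply: (@le_trans _ _ ((1 - al) * Gamma (1 - al) * M)); last by rewrite ler_wpM2r.
  by rewrite ler_pM2l// mulr_gt0.
by have := lt_le_trans hb (le_trans (lerB h1 h2) (le_trans h h3)); rewrite ltxx.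
Qed.

Lemma cvg_at_left_id (R : realType) (c : R) : x @[x --> c^'-] --> c.
Proof. by apply: cvg_at_left_filter; exact: cvg_id. Qed.

Lemma onem_cvg_left1 (R : realType) : (1 - al) @[al --> (1 : R)^'-] --> (0 : R).
Proof.
rewrite -[X in _ --> X](subrr (1 : R)); apply: cvgB; first exact: cvg_cst.
exact: cvg_at_left_id.
Qed.

(** The two sides tend to M and A respectively. *)
Lemma barrier_eventually (R : realType) (eta A M C : R) : 0 < eta -> M < A ->
  \forall al \near (1 : R)^'-,
    (1 + (1 - al)) * M < al * A * eta `^ (1 - al) - (1 - al) * C.
Proof.
move=> eta0 MA.
pose phi (al : R) := al * A * eta `^ (1 - al) - (1 - al) * C - (1 + (1 - al)) * M.
have c1 := @onem_cvg_left1 R.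
have : phi al @[al --> (1 : R)^'-] --> 1 * A * eta `^ 0 - 0 * C - (1 + 0) * M.
  apply: cvgB; last by apply: cvgMl; apply: cvgD => //; exact: cvg_cst.
  apply: cvgB; last by apply: cvgMl.
  apply: cvgM; last exact: powR_exponent_cvg.
  by apply: cvgMl; exact: cvg_at_left_id.
rewrite powRr0 => /cvgrPdist_lt/(_ (A - M)); rewrite subr_gt0 => /(_ MA).
apply: filterS => al; rewrite /phi ltr_norml => /andP[_]; lra.
Qed.

(** * Uniform bounds for al close to 1: local extension and barriers *)

Definition eventually_bounded (R : realType) (a : R) (y : R -> R -> R) (T : R) : Prop :=
  exists2 K : R, 0 <= K &
    \forall al \near (1 : R)^'-, forall t, a <= t <= T -> `|y al t| <= K.

(** What the uniform bounds take from the continuity of f; it passes to the reflected right-hand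
    side - f t (- x) of [lower_barrier]. *)
Definition locally_bounded (R : realType) (a b : R) (f : R -> R -> R) : Prop :=
  forall lo hi : R, exists2 M, 0 <= M &
    forall t x, a <= t <= b -> lo <= x <= hi -> `|f t x| <= M.

Section family.
Context (R : realType) (a b : R) (f u y : R -> R -> R) (ystar : R -> R).
Hypotheses (ab : a < b) (fb : locally_bounded a b f).
Hypothesis sol : forall al, 0 < al < 1 ->
  caputo_abel a b al (u al) (y al) (fun t => f t (y al t)).
Hypothesis lim_y : forall t, a <= t <= b -> y al t @[al --> 1^'-] --> ystar t.

Lemma eventually_bounded_rhs (T : R) : T <= b -> eventually_bounded a y T ->
  exists2 M, 0 <= M &
  \forall al \near (1 : R)^'-, forall t, a <= t <= T -> `|f t (y al t)| <= M.
Proof.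
move=> Tb [K K0 hK]; have [M M0 hM] := fb (- K) K; exists M => //.
apply: filterS hK => al hK t /andP[at_ tT]; apply: hM; first by rewrite at_ (le_trans tT).
by rewrite -ler_norml; apply: hK; rewrite at_.
Qed.

Lemma eventually_holder (T : R) : T <= b -> eventually_bounded a y T ->
  exists2 C, 0 <= C & \forall al \near (1 : R)^'-,
    forall s t, a <= s -> s < t -> t <= T -> t - s <= 1 ->
    `|y al t - y al s| <= C * (t - s) `^ 2^-1.
Proof.
move=> Tb /(eventually_bounded_rhs Tb)[M M0 hM]; exists (8 * M); first by rewrite mulr_ge0.
move: (near_left1 R) hM; apply: filterS2 => al [al2 al01] hM s t as_ st tT ts1.
apply: (caputo_abel_holder al01 (sol al01)) => //; first exact: le_trans tT Tb.
move=> r /andP[ar rt]; apply: hM.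
by rewrite (ltW ar) (le_trans (ltW rt)).
Qed.

(** While |y| <= K + 1 the right-hand side is at most M, so by the Hoelder estimate y moves by at
    most 8 M d^(1/2) < 1 during a time d chosen independently of al, and cannot reach K + 1. *)
Lemma eventually_bounded_step (T : R) : a <= T -> T < b -> eventually_bounded a y T ->
  exists2 T', T < T' <= b & eventually_bounded a y T'.
Proof.
move=> aT Tb [K K0 hK]; have [M M0 hM] := fb (- (K + 1)) (K + 1).
have bT : 0 < b - T by rewrite subr_gt0.
have [d [d0 d1 db dM]] := exists_small_holder (8 * M) (@ltr01 R) bT.
have Tdb : T + d <= b by lra.
exists (T + d); first by rewrite ltrDl d0.
exists (K + 1); first by rewrite addr_ge0.
move: (near_left1 R) hK; apply: filterS2 => al [al2 al01] hK t /andP[at_ tTd].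
rewrite leNgt; apply/negP => yt.
have Tt : T < t.
  rewrite ltNge; apply/negP => tT; move: yt; rewrite ltNge => /negP; apply.
  by apply: (@le_trans _ _ K); [apply: hK; rewrite at_|rewrite lerDl].
pose w s := `|y al s| - (K + 1).
have cw : {within `[T, T + d], continuous w}.
  have cy : {within `[T, T + d], continuous (y al)}.
    apply: continuous_subspaceW (caputo_abel_continuous (sol al01) (ltW ab)).
    by apply: subset_itv; rewrite bnd_simp.
  move=> x; apply: cvgB; last exact: cvg_cst.
  by apply: cvg_norm; exact: cy.
have wT : w T < 0.
  have := hK T; rewrite aT lexx => /(_ isT); rewrite /w; lra.
(* Stopping at the first time with |y| = K + 1 makes the bound M available on all of ]a, t1[, so the
   Hoelder estimate is not circular. *)
have [t1 [/andP[Tt1 t1d] wt1 wlt]] : exists t,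
    [/\ T < t <= T + d, w t = 0 & forall s, T <= s < t -> w s < 0].
  apply: (@first_zero _ w T (T + d) t) => //; first by rewrite (ltW Tt) tTd.
  by rewrite /w; lra.
have yb r : a < r < t1 -> `|f r (y al r)| <= M.
  move=> /andP[ar rt1]; apply: hM; first by rewrite (ltW ar)/=; lra.
  rewrite -ler_norml; have [rT|Tr] := leP r T.
    by apply: (@le_trans _ _ K); [apply: hK; rewrite (ltW ar)|rewrite lerDl].
  by have := wlt r; rewrite (ltW Tr) rt1 => /(_ isT); rewrite /w; lra.
have t1T : t1 - T <= 1 by lra.
have t1b : t1 <= b by lra.
have := caputo_abel_holder al01 (sol al01) al2 aT Tt1 t1b t1T yb.
have h2 : (t1 - T) `^ 2^-1 <= d `^ 2^-1.
  by apply: ge0_ler_powR; rewrite ?nnegrE ?invr_ge0//; lra.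
have h3 : 8 * M * (t1 - T) `^ 2^-1 <= 8 * M * d `^ 2^-1 by rewrite ler_wpM2l// mulr_ge0.
have h4 : `|y al t1| <= `|y al t1 - y al T| + `|y al T|.
  by rewrite -[X in `|X| <= _](subrK (y al T)) ler_normD.
have := hK T; rewrite aT lexx => /(_ isT); move: wt1; rewrite /w; lra.
Qed.

(** The limit controls y only at the point T1. The uniform Hoelder bound spreads y < q to a window
    of length eta before T1, half of the gap q - [ystar T1] going to the convergence and half to the
    oscillation; [line_barrier] then starts at the left end of the window. *)
Lemma upper_barrier (T1 T2 q M : R) : a < T1 -> T1 < T2 -> T2 <= b ->
  eventually_bounded a y T1 -> ystar T1 < q -> 0 <= M ->
  (forall t x, a <= t <= b -> q <= x <= q + 1 -> f t x <= M) ->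
  (M + 1) * (T2 - T1) < 1 ->
  \forall al \near (1 : R)^'-, forall t, T1 <= t <= T2 -> y al t < q + 1.
Proof.
move=> aT1 T12 T2b EB yq M0 fM MT.
have T1b : T1 <= b by lra.
have [C C0 hC] := eventually_holder T1b EB.
have [K K0 hK] := EB.
have M10 : 0 < M + 1 by rewrite ltr_wpDl.
(* The first bound keeps T0 = T1 - eta above a, the second keeps (M + 1) (T2 - T0) below 1. *)
have e1 : 0 < Num.min (T1 - a) ((1 - (M + 1) * (T2 - T1)) / (M + 1)).
  by rewrite lt_min subr_gt0 aT1/= divr_gt0 ?subr_gt0.
have c1 : 0 < (q - ystar T1) / 2 by rewrite divr_gt0 ?subr_gt0.
have [eta [eta0 eta1 etae etaC]] := exists_small_holder C c1 e1.
move: etae; rewrite lt_min => /andP[etaa]; rewrite ltr_pdivlMr// => etaM.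
have MA : M < M + 1 by rewrite ltrDl.
pose C1 := `|q| + K.
have hb := barrier_eventually (C1 / eta) eta0 MA.
have aT1b : a <= T1 <= b by rewrite (ltW aT1).
have /cvgrPdist_lt/(_ _ c1) hl := lim_y aT1b.
near=> al.
have [al2 al01] : 2^-1 <= al /\ 0 < al < 1 by near: al; exact: near_left1.
have hC' : forall s t, a <= s -> s < t -> t <= T1 -> t - s <= 1 ->
    `|y al t - y al s| <= C * (t - s) `^ 2^-1 by near: al.
have hK' : forall t, a <= t <= T1 -> `|y al t| <= K by near: al.
have hb' : (1 + (1 - al)) * M < al * (M + 1) * eta `^ (1 - al) - (1 - al) * (C1 / eta).
  by near: al.
have hl' : `|ystar T1 - y al T1| < (q - ystar T1) / 2 by near: al.
have [al0 al1] := andP al01.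
pose T0 := T1 - eta.
have aT0 : a < T0 by rewrite /T0; lra.
have before r : T0 <= r <= T1 -> y al r < q.
  move=> /andP[T0r]; rewrite le_eqVlt => /predU1P[->|rT1].
    by move: hl'; rewrite ltr_norml => /andP[]; lra.
  have ar : a <= r by lra.
  have T1r : T1 - r <= eta by rewrite /T0 in T0r; lra.
  have := hC' r T1 ar rT1 (lexx _) (le_trans T1r eta1).
  have : C * (T1 - r) `^ 2^-1 <= C * eta `^ 2^-1.
    by rewrite ler_wpM2l//; apply: ge0_ler_powR; rewrite ?nnegrE ?invr_ge0//; lra.
  by move: hl'; rewrite ltr_norml ler_norml => /andP[? ?] ? /andP[? ?]; lra.
apply: (@line_barrier R a b al (u al) (y al) _ T0 T1 T2 q M eta C1 al01 (sol al01)) => //.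
- by rewrite /T0 subrK.
- by rewrite addr_ge0.
- rewrite (_ : T2 - T0 = (T2 - T1) + eta); last by rewrite /T0; ring.
  by rewrite mulrDr [_ * eta]mulrC -ltrBrDl.
- move=> r /andP[ar rT0]; have T0T1 : T0 <= T1 by rewrite gerBl ltW.
  have := hK' r; rewrite ar (le_trans rT0 T0T1) => /(_ isT).
  rewrite ler_norml /C1 => /andP[_ yK]; apply: (le_trans yK).
  by rewrite addrA lerDr -lerBlDl sub0r -normrN ler_norm.
- by move=> t tab qy; apply: fM.
Unshelve. all: by end_near. Qed.

End family.

(** * Continuation of the uniform bound to the whole interval *)

Lemma near_left_ex (R : realType) (c : R) (P Q : R -> Prop) :
  (\forall x \near c^'-, P x) -> (\forall x \near c^'-, Q x) -> exists x, P x /\ Q x.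
Proof. by move=> hP hQ; apply: (@filter_ex _ (c^'-)); exact: filterI. Qed.

Lemma caputo_abel_opp (R : realType) (a b al : R) (u y g : R -> R) :
  caputo_abel a b al u y g ->
  caputo_abel a b al (fun t => - u t) (fun t => - y t) (fun t => - g t).
Proof.
move=> [ui yE ki kE].
have RN (D : set (measurableTypeR R)) (h : R -> R) : measurable D ->
    lebesgue_measure.-integrable D (EFin \o h) ->
    \int[lebesgue_measure]_(s in D) (- h s) = - \int[lebesgue_measure]_(s in D) h s.
  by move=> mD hi; under eq_Rintegral do rewrite -mulN1r; rewrite RintegralZl// mulN1r.
have iN (D : set (measurableTypeR R)) (h : R -> R) : measurable D ->
    lebesgue_measure.-integrable D (EFin \o h) ->
    lebesgue_measure.-integrable D (EFin \o (fun s => - h s)).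
  move=> mD hi; apply: eq_integrable (integrable_mulrl (-1) mD hi) => //.
  by move=> x _; rewrite /= mulN1r.
split.
- exact: iN.
- move=> t atb; rewrite yE// RN ?opprD//.
  apply: integrableS ui => //; apply: subset_itvl; rewrite bnd_simp.
  by case/andP: atb.
- move=> t atb; apply: eq_integrable (iN _ _ _ (ki _ atb)) => //.
  by move=> s _; rewrite /= mulrN.
- move=> t atb; under eq_Rintegral do rewrite mulrN.
  by rewrite RN// ?kE// ?mulrN//; exact: ki.
Qed.

Section continuation.
Context (R : realType) (a b : R) (f u y : R -> R -> R) (ystar : R -> R).
Hypotheses (ab : a < b) (fb : locally_bounded a b f).
Hypothesis sol : forall al, 0 < al < 1 ->
  caputo_abel a b al (u al) (y al) (fun t => f t (y al t)).
Hypothesis lim_y : forall t, a <= t <= b -> y al t @[al --> 1^'-] --> ystar t.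

(** [upper_barrier] applied to - y, which solves the equation with right-hand side - f t (- x). *)
Lemma lower_barrier (T1 T2 q M : R) : a < T1 -> T1 < T2 -> T2 <= b ->
  eventually_bounded a y T1 -> q < ystar T1 -> 0 <= M ->
  (forall t x, a <= t <= b -> q - 1 <= x <= q -> - M <= f t x) ->
  (M + 1) * (T2 - T1) < 1 ->
  \forall al \near (1 : R)^'-, forall t, T1 <= t <= T2 -> q - 1 < y al t.
Proof.
move=> aT1 T12 T2b [K K0 hK] qy M0 fM MT.
pose f' t x := - f t (- x); pose y' al t := - y al t.
have fb' : locally_bounded a b f'.
  move=> lo hi; have [M' M'0 hM'] := fb (- hi) (- lo); exists M' => // t x tab /andP[lox xhi].
  by rewrite normrN; apply: hM' => //; rewrite !lerN2 lox xhi.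
have sol' al : 0 < al < 1 ->
    caputo_abel a b al (fun t => - u al t) (y' al) (fun t => f' t (y' al t)).
  move=> /sol/caputo_abel_opp; congr caputo_abel.
  by apply/funext => t; rewrite /f' /y' opprK.
have lim' t : a <= t <= b -> y' al t @[al --> 1^'-] --> - ystar t.
  by move=> tab; apply: cvgN; exact: lim_y.
have EB' : eventually_bounded a y' T1.
  by exists K => //; apply: filterS hK => al hK t tT; rewrite normrN; exact: hK.
have qy' : - ystar T1 < - q by rewrite ltrN2.
have fM' t x : a <= t <= b -> - q <= x <= - q + 1 -> f' t x <= M.
  by move=> tab qx; rewrite lerNl; apply: fM => //; lra.
have := @upper_barrier R a b f' _ y' (fun t => - ystar t) fb' sol' lim'
   T1 T2 (- q) M aT1 T12 T2b EB' qy' M0 fM' MT.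
apply: filterS => al h t tT; have := h t tT; rewrite /y'; lra.
Qed.

(* The values y al T converge to c, although a priori y al may be huge just
   before T.  At a time T1 shortly before T, where y al is already controlled,
   the barriers exclude ystar T1 < c - 2 and ystar T1 > c + 2, since y al could
   not come back to c at time T; they then confine y al on [T1, T]. *)
Lemma eventually_bounded_closed (T : R) : a < T <= b ->
  (forall T', a <= T' < T -> eventually_bounded a y T') -> eventually_bounded a y T.
Proof.
move=> /andP[aT Tb] EB; pose c := ystar T.
(* This range contains the four strips used below: [c - 2, c - 1], [c + 1, c + 2], [c + 3, c + 4]
   and [c - 4, c - 3]. *)
have [M M0 hM] := fb (c - 4) (c + 4).
have M10 : 0 < M + 1 by rewrite ltr_wpDl.
(* The first bound keeps T1 above a; the second gives (M + 1) d <= 1/2, as the barriers require. *)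
pose d := Num.min ((T - a) / 2) ((M + 1)^-1 / 2).
have d0 : 0 < d by rewrite lt_min !divr_gt0 ?subr_gt0 ?invr_gt0.
have da : d <= (T - a) / 2 by rewrite ge_min lexx.
have dM : d <= (M + 1)^-1 / 2 by rewrite ge_min lexx orbT.
pose T1 := T - d.
have aT1 : a < T1 by rewrite /T1; lra.
have T1T : T1 < T by rewrite /T1; lra.
have MT : (M + 1) * (T - T1) < 1.
  have : (M + 1) * d <= (M + 1) * ((M + 1)^-1 / 2) by rewrite ler_pM2l.
  rewrite mulrA mulfV ?gt_eqF// /T1 (_ : T - (T - d) = d); last ring.
  by lra.
have EB1 : eventually_bounded a y T1 by apply: EB; rewrite (ltW aT1).
have TT : T1 <= T <= T by rewrite lexx ltW.
have /cvgrPdist_lt/(_ 1 ltr01) yT : y al T @[al --> 1^'-] --> c.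
  by apply: lim_y; rewrite (ltW aT).
have fle t x : a <= t <= b -> c - 4 <= x <= c + 4 -> - M <= f t x <= M.
  by move=> tab xc; rewrite -ler_norml; exact: hM.
(* Otherwise the barrier gives y al T < c - 1, although y al T is within 1 of c for al close to
   1. *)
have vlo : c - 2 <= ystar T1.
  rewrite leNgt; apply/negP => v.
  have h : \forall al \near (1 : R)^'-, forall t, T1 <= t <= T -> y al t < (c - 2) + 1.
    apply: (upper_barrier fb sol lim_y aT1 T1T Tb EB1 v M0 _ MT) => t x tab xc.
    by have /andP[] : - M <= f t x <= M by apply: fle => //; lra.
  have [al [+ /(_ T TT)]] := near_left_ex yT h.
  by rewrite ltr_norml => /andP[]; lra.
have vhi : ystar T1 <= c + 2.
  rewrite leNgt; apply/negP => v.
  have h : \forall al \near (1 : R)^'-, forall t, T1 <= t <= T -> (c + 2) - 1 < y al t.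
    apply: (lower_barrier aT1 T1T Tb EB1 v M0 _ MT) => t x tab xc.
    by have /andP[] : - M <= f t x <= M by apply: fle => //; lra.
  have [al [+ /(_ T TT)]] := near_left_ex yT h.
  by rewrite ltr_norml => /andP[]; lra.
have v3 : ystar T1 < c + 3 by lra.
have up : \forall al \near (1 : R)^'-, forall t, T1 <= t <= T -> y al t < (c + 3) + 1.
  apply: (upper_barrier fb sol lim_y aT1 T1T Tb EB1 v3 M0 _ MT) => t x tab xc.
  by have /andP[] : - M <= f t x <= M by apply: fle => //; lra.
have v3' : c - 3 < ystar T1 by lra.
have lo : \forall al \near (1 : R)^'-, forall t, T1 <= t <= T -> (c - 3) - 1 < y al t.
  apply: (lower_barrier aT1 T1T Tb EB1 v3' M0 _ MT) => t x tab xc.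
  by have /andP[] : - M <= f t x <= M by apply: fle => //; lra.
have [K K0 hK] := EB1; exists (K + (`|c| + 4)); first by rewrite !addr_ge0.
move: hK up lo; apply: filterS3 => al hK up lo t /andP[at_ tT].
have [tT1|T1t] := leP t T1.
  by apply: (@le_trans _ _ K); [apply: hK; rewrite at_|rewrite lerDl addr_ge0].
have tt : T1 <= t <= T by rewrite (ltW T1t).
have := up t tt; have := lo t tt; have := ler_norm c; have := ler_norm (- c).
rewrite normrN ler_norml => *; apply/andP; split; lra.
Qed.

(** Continuation on the set S of good end points: the common initial value puts a in S,
    [eventually_bounded_closed] puts sup S in S, and [eventually_bounded_step] contradicts sup S <
    b. *)
Lemma eventually_bounded_full (ya : R) :
  (forall al, 0 < al < 1 -> y al a = ya) -> eventually_bounded a y b.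
Proof.
move=> hya.
pose S := [set T | a <= T <= b /\ eventually_bounded a y T].
have Sa : S a.
  split; first by rewrite lexx ltW.
  exists `|ya| => //; apply: filterS (near_left1 R) => al [_ al01] t ata.
  by rewrite (_ : t = a) ?hya//; apply/eqP; rewrite eq_le andbC.
have hS : has_sup S by split; [exists a|exists b => T [/andP[]]].
have [aS Sb] : a <= sup S /\ sup S <= b.
  split; first by apply: ub_le_sup => //; case: hS.
  by apply: ge_sup; [exists a|move=> T [/andP[]]].
have down T : a <= T < sup S -> eventually_bounded a y T.
  move=> /andP[aT TS]; have e0 : 0 < sup S - T by rewrite subr_gt0.
  have [T' [_ [K K0 hK]] TT'] := sup_adherent e0 hS.
  exists K => //; apply: filterS hK => al hK t /andP[at_ tT]; apply: hK.
  by rewrite at_/=; lra.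
have EBs : eventually_bounded a y (sup S).
  move: aS; rewrite le_eqVlt => /predU1P[<-|aS]; first by case: Sa.
  by apply: eventually_bounded_closed => //; rewrite aS.
move: Sb; rewrite le_eqVlt => /predU1P[<-//|Sb].
have [T' /andP[sT' T'b] EB'] := eventually_bounded_step ab fb sol aS Sb EBs.
have : T' <= sup S.
  apply: ub_le_sup; first by case: hS.
  by split => //; rewrite (le_trans aS (ltW sT')).
by rewrite leNgt sT'.
Qed.

End continuation.

(** * Passage to the limit in the Volterra estimate *)

Lemma powR_cvg_left1 (R : realType) (c : R) : 0 <= c -> c `^ al @[al --> 1^'-] --> c.
Proof.
rewrite le_eqVlt => /predU1P[<-|c0].
  apply: cvg_near_cst; apply: filterS (near_left1 R) => al [_ /andP[al0 _]].
  by rewrite powR0// gt_eqF.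
rewrite -[X in _ --> X](powRr1 (ltW c0)).
by apply: powR_exponent_cvg => //; exact: cvg_at_left_id.
Qed.

Lemma Gamma_onem_cvg (R : realType) :
  (1 - al) * Gamma (1 - al) @[al --> (1 : R)^'-] --> (1 : R).
Proof.
apply: (@squeeze_cvgr _ _ _ _ (fun al => 1 - (1 - al)) (fun al => 1 + (1 - al))).
- apply: filterS (near_left1 R) => al [_ al01]; apply: Gamma_bounds.
  by apply/andP; split; lra.
- rewrite -[X in _ --> X](subr0 (1 : R)); apply: cvgB; first exact: cvg_cst.
  exact: onem_cvg_left1.
- rewrite -[X in _ --> X](addr0 (1 : R)); apply: cvgD; first exact: cvg_cst.
  exact: onem_cvg_left1.
Qed.

Lemma beta_const_onem_cvg (R : realType) :
  (1 - al) * beta_const (1 - al) @[al --> (1 : R)^'-] --> (1 : R).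
Proof.
apply: (@squeeze_cvgr _ _ _ _ (fun=> 1) (fun al => 1 + 2 * (1 - al) / (1 - (1 - al)))).
- apply: filterS (near_left1 R) => al [_ al01].
  by apply: (proj2 (beta_const_bounds (_ : 0 < 1 - al < 1))); apply/andP; split; lra.
- exact: cvg_cst.
- have h0 := @onem_cvg_left1 R.
  have e1 : 1 + 2 * 0 / (1 - 0) = 1 :> R by rewrite mulr0 mul0r addr0.
  rewrite -[X in _ --> X]e1.
  apply: cvgD; first exact: cvg_cst.
  apply: cvgM; first by apply: cvgM; [exact: cvg_cst|exact: h0].
  apply: cvgV; first by rewrite subr0 oner_neq0.
  by apply: cvgB; [exact: cvg_cst|exact: h0].
Qed.

Section limit.
Context (R : realType) (a b : R) (f u y : R -> R -> R) (ystar : R -> R).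
Hypotheses (ab : a < b) (fb : locally_bounded a b f).
Hypothesis sol : forall al, 0 < al < 1 ->
  caputo_abel a b al (u al) (y al) (fun t => f t (y al t)).
Hypothesis lim_y : forall t, a <= t <= b -> y al t @[al --> 1^'-] --> ystar t.

(** [caputo_abel_estimate] multiplied by 1 - al: the Gamma and beta factors tend to 1, and the
    memory term disappears since (t - a) - (x - a) + (x - t) = 0. *)
Lemma limit_increment (t x l eta : R) : a <= t -> t < x -> x <= b ->
  eventually_bounded a y b ->
  (\forall al \near (1 : R)^'-, forall r, t < r < x -> `|f r (y al r) - l| <= eta) ->
  `|ystar x - ystar t - l * (x - t)| <= eta * (x - t).
Proof.
move=> at_ tx xb /(eventually_bounded_rhs fb (lexx b))[M M0 hM] hl.
have al1 : al @[al --> (1 : R)^'-] --> (1 : R) by exact: cvg_at_left_id.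
have ial1 : al^-1 @[al --> (1 : R)^'-] --> (1 : R).
  by rewrite -[X in _ --> X](invr1 R); apply: cvgV => //; exact: oner_neq0.
have pcvg c : 0 <= c -> c `^ al / al @[al --> (1 : R)^'-] --> c.
  by move=> c0; rewrite -[X in _ --> X]mulr1; apply: cvgM => //; exact: powR_cvg_left1.
have xt0 : 0 <= x - t by rewrite subr_ge0 ltW.
have ta0 : 0 <= t - a by rewrite subr_ge0.
have xa0 : 0 <= x - a by lra.
have hL : `|(1 - al) * beta_const (1 - al) * (y al x - y al t) -
           (1 - al) * Gamma (1 - al) * (l * ((x - t) `^ al / al))| @[al --> (1 : R)^'-]
    --> `|1 * (ystar x - ystar t) - 1 * (l * (x - t))|.
  apply: cvg_norm; apply: cvgB.
    apply: cvgM; first exact: beta_const_onem_cvg.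
    by apply: cvgB; apply: lim_y; lra.
  apply: cvgM; first exact: Gamma_onem_cvg.
  by apply: cvgM; [exact: cvg_cst|exact: pcvg].
have hR : (1 - al) * Gamma (1 - al) * (eta * ((x - t) `^ al / al) +
      M * (((t - a) `^ al / al - (x - a) `^ al / al) + (x - t) `^ al / al))
      @[al --> (1 : R)^'-] --> 1 * (eta * (x - t) + M * ((t - a) - (x - a) + (x - t))).
  apply: cvgM; first exact: Gamma_onem_cvg.
  apply: cvgD; first by apply: cvgM; [exact: cvg_cst|exact: pcvg].
  apply: cvgM; first exact: cvg_cst.
  by apply: cvgD; [apply: cvgB; exact: pcvg|exact: pcvg].
have := ler_cvg_to hL hR.
rewrite !mul1r (_ : t - a - (x - a) + (x - t) = 0); last by ring.
rewrite mulr0 addr0; apply.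
move: (near_left1 R) hM hl; apply: filterS3 => al [_ al01] hM hl.
have [al0 al1'] := andP al01; have z0 : 0 < 1 - al by lra.
have gM r : a < r < x -> `|f r (y al r)| <= M.
  by move=> /andP[ar rx]; apply: hM; rewrite (ltW ar) (le_trans (ltW rx)).
have aln0 : al != 0 by rewrite gt_eqF.
have := caputo_abel_estimate al01 (sol al01) at_ tx xb hl gM.
rewrite -(ler_pM2l z0) => h; apply: (le_trans (le_trans _ h)).
  by rewrite -[X in _ <= X * _](gtr0_norm z0) -normrM [X in _ <= `|X|]mulrBr !mulrA.
by rewrite le_eqVlt; apply/orP; left; apply/eqP; field.
Qed.

Hypothesis hf : {within `[a, b] `*` [set: R], continuous (fun p : R * R => f p.1 p.2)}.

(** Near t, the uniform Hoelder bound and convergence at the single point t keep y al r close to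
    [ystar t], so f r (y al r) is within e / 2 of l for all al close to 1, and [limit_increment]
    bounds the difference quotient. *)
Lemma limit_is_derive_on (t : R) : a <= t <= b -> eventually_bounded a y b ->
  is_derive_on `[a, b] ystar t (f t (ystar t)).
Proof.
move=> tab EB; have [at_ tb] := andP tab.
apply/cvgrPdist_lt => e e0; pose l := f t (ystar t).
have e20 : 0 < e / 2 by lra.
have [d d0 hd] : exists2 d, 0 < d & forall r v, a <= r <= b ->
    `|t - r| < d -> `|ystar t - v| < d -> `|f r v - l| <= e / 2.
  have /subspace_continuousP/(_ (t, ystar t)) := hf.
  have tD : (`[a, b]%classic `*` [set: R]) (t, ystar t) by split; rewrite //= in_itv.
  move=> /(_ tD)/cvgrPdist_lt/(_ _ e20).
  rewrite near_withinE => /nbhs_ballP[d d0 dw]; exists d => // r v rab tr yv.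
  rewrite distrC; apply/ltW; apply: (dw (r, v)); first by split.
  by split; rewrite //= in_itv.
have [C C0 hC] := eventually_holder fb sol (lexx b) EB.
have d20 : 0 < d / 2 by lra.
have [dl [dl0 dl1 dld dlC]] := exists_small_holder C d20 d0.
(* Stated for an interval around t so that r0 = t and r1 = t give the right and left difference
   quotients. *)
have close r0 r1 : a <= r0 -> r0 < r1 -> r1 <= b -> r0 <= t <= r1 -> r1 - r0 < dl ->
    `|ystar r1 - ystar r0 - l * (r1 - r0)| <= e / 2 * (r1 - r0).
  move=> ar0 r01 r1b /andP[r0t tr1] r10; apply: limit_increment => //.
  have /cvgrPdist_lt/(_ _ d20) hy := lim_y tab.
  move: hC hy; apply: filterS2 => al hC hy r /andP[r0r rr1].
  have yr : `|y al r - y al t| < d / 2.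
    have pw s : 0 <= s -> s <= dl -> C * s `^ 2^-1 < d / 2.
      move=> s0 sdl; apply: le_lt_trans dlC; rewrite ler_wpM2l//.
      by apply: ge0_ler_powR; rewrite ?nnegrE ?invr_ge0//; lra.
    have [rt|tr|->] := ltgtP r t; last by rewrite subrr normr0.
    - rewrite distrC; apply: le_lt_trans (hC r t _ rt tb _) _; [lra|lra|].
      by apply: pw; lra.
    - apply: le_lt_trans (hC t r at_ tr _ _) _; [lra|lra|].
      by apply: pw; lra.
  apply: hd; first by apply/andP; split; lra.
    by rewrite ltr_norml; apply/andP; split; lra.
  by move: yr hy; rewrite !ltr_norml => /andP[? ?] /andP[? ?]; apply/andP; split; lra.
rewrite near_withinE; near=> x => /=; rewrite in_itv/= => /andP[ax xb].
have xt : x != t by near: x; exact: nbhs_dnbhs_neq.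
have xdl : `|t - x| < dl by near: x; apply: nbhs_dnbhs; exact: nbhsx_ballx.
move: xdl; rewrite ltr_norml => /andP[xd1 xd2].
have xt0 : x - t != 0 by rewrite subr_eq0.
have E : l - (ystar x - ystar t) / (x - t) = - ((ystar x - ystar t - l * (x - t)) / (x - t)).
  by field.
rewrite -/l E normrN normrM normfV ltr_pdivrMr ?normr_gt0//.
have [xlt|tlx|xe] := ltgtP x t; last by rewrite xe eqxx in xt.
- have := close x t ax xlt tb _ _; rewrite (ltW xlt) lexx => /(_ isT) h.
  have {}h := h (ltac:(lra)).
  rewrite (_ : ystar x - ystar t - _ = - (ystar t - ystar x - l * (t - x))); last ring.
  rewrite normrN [`|x - t|]distrC (gtr0_norm (_ : 0 < t - x)) ?subr_gt0//.
  apply: le_lt_trans h _; rewrite ltr_pM2r ?subr_gt0//; lra.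
- have := close t x at_ tlx xb _ _; rewrite (ltW tlx) lexx => /(_ isT) h.
  have {}h := h (ltac:(lra)).
  rewrite (gtr0_norm (_ : 0 < x - t)) ?subr_gt0//.
  apply: le_lt_trans h _; rewrite ltr_pM2r ?subr_gt0//; lra.
Unshelve. all: by end_near. Qed.

End limit.

(** * Reduction of the theorem to the preceding setting *)

Lemma within_continuous_locally_bounded (R : realType) (a b : R) (f : R -> R -> R) :
  {within `[a, b] `*` [set: R], continuous (fun p : R * R => f p.1 p.2)} ->
  locally_bounded a b f.
Proof.
move=> hf lo hi.
have cA : compact (`[a, b]%classic `*` `[lo, hi]%classic : set (R * R)).
  by apply: compact_setX; exact: segment_compact.
have /continuous_compact/(_ cA)/compact_bounded[M [_ hM]] :
    {within `[a, b] `*` `[lo, hi], continuous (fun p : R * R => f p.1 p.2)}.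
  by apply: continuous_subspaceW hf => p [].
exists (`|M| + 1); first by rewrite addr_ge0.
(* [compact_bounded] bounds the image by every real larger than M, whose sign is unknown. *)
move=> t x tab xlh; apply: (hM (`|M| + 1)).
  by rewrite ltr_pwDr// ler_norm.
by exists (t, x) => //; split; rewrite /= in_itv.
Qed.

Lemma caputo_solution_abel (R : realType) (a b ya al : R) (f : R -> R -> R) (y : R -> R) :
  0 < al < 1 -> caputo_solution a b ya f al y ->
  caputo_abel a b al (derive1 y) y (fun t => f t (y t)).
Proof.
move=> al01 [[_ ui yE] _ eqn]; split => //.
- by move=> t tab; have [] := eqn t (ltac:(by rewrite in_itv)).
- move=> t tab; have [_ <-] := eqn t (ltac:(by rewrite in_itv)).
  have z01 : 0 < 1 - al < 1 by apply/andP; split; lra.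
  by rewrite /caputo mulVKf// gt_eqF// Gamma_gt0.
Qed.

Unset Implicit Arguments.

Theorem theorem1 (R : realType) (a b ya : R) (f : R -> R -> R)
    (y : R -> R -> R) (ystar : R -> R)
    (hab : a < b)
    (hf : {within `[a, b] `*` [set: R],
             continuous (fun p : R * R => f p.1 p.2)})
    (hy : forall alpha : R, 0 < alpha < 1 ->
            caputo_solution a b ya f alpha (y alpha))
    (hlim : forall t : R, t \in `[a, b] ->
              (y alpha t @[alpha --> 1^'-] --> ystar t) /\
              (y alpha t @[alpha --> 1^'+] --> ystar t)) :
  cauchy_solution a b ya f ystar.
Proof.
have fb := within_continuous_locally_bounded hf.
have sol al (al01 : 0 < al < 1) := caputo_solution_abel al01 (hy al al01).
have lim_y t : a <= t <= b -> y al t @[al --> 1^'-] --> ystar t.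
  by move=> tab; have [] := hlim t (ltac:(by rewrite in_itv)).
have hya al : 0 < al < 1 -> y al a = ya by move=> /hy[].
have EB := eventually_bounded_full hab fb sol lim_y hya.
split.
  (* The initial value is known for al in ]0, 1[, that is, eventually to the left of 1; uniqueness
     of limits does the rest. *)
  have ya_cvg : y al a @[al --> 1^'-] --> ya.
    apply: cvg_near_cst; apply: filterS (near_left1 R) => al [_ al01].
    exact: hya.
  have aab : a <= a <= b by rewrite lexx ltW.
  exact: (cvg_unique _ (lim_y a aab) ya_cvg).
move=> t; rewrite in_itv/= => tab.
exact: (limit_is_derive_on fb sol lim_y hf tab EB).
Qed.
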